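(* Let $E$ be a symmetric space on $I=[0,\infty)$ with the Fatou property, and let $\phi$ be its fundamental function. Then the following conditions are equivalent. (i) $E$ is order continuous and $E$ is not embedded in $L^1[0,\infty)$. (ii) $E$ is order continuous and $E'\hookrightarrow\{f: f^*(\infty)=0\}$ (i.e. every $f\in E'$ satisfies $f^*(\infty)=0$). (iii) $E$ is $K$-order continuous and $\phi(\infty)=\infty$.
   Context: Let $I=[0,\infty)$ with Lebesgue measure $\mu$, and let $L^0$ be the set of (classes of a.e. equal) extended real valued measurable functions on $I$. A Banach function space $(E,\|\cdot\|_E)$ is a Banach lattice that is a sublattice of $L^0$ such that (1) if $x\in L^0$, $y\in E$, $|x|\le|y|$ a.e., then $x\in E$ and $\|x\|_E\le\|y\|_E$; (2) there is a strictly positive $x\in E$. $E^+=\{x\in E:x\ge 0\}$. Fatou property: if $(x_n)\subset E^+$, $\sup_n\|x_n\|_E<\infty$ and $x_n\uparrow x\in L^0$, then $x\in E$ and $\|x_n\|_E\uparrow\|x\|_E$. For $x\in L^0$: $d_x(\lambda)=\mu\{s\in I:|x(s)|>\lambda\}$, $x^*(t)=\inf\{\lambda>0:d_x(\lambda)\le t\}$, $x^{**}(t)=\frac1t\int_0^t x^*(s)\,ds$, $x^*(\infty)=\lim_{t\to\infty}x^*(t)$. $E$ is symmetric if $x\in L^0$, $y\in E$, $d_x=d_y$ imply $x\in E$ and $\|x\|_E=\|y\|_E$. For $x,y\in L^1+L^\infty$, $x\prec y$ means $x^{**}(t)\le y^{**}(t)$ for all $t>0$. The fundamental function is $\phi(t)=\|\chi_{(0,t)}\|_E$,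 and $\phi(\infty)=\lim_{t\to\infty}\phi(t)$. The associate space is $E'=\{y\in L^0:\int_I|xy|\,d\mu<\infty\ \forall x\in E\}$ with norm $\|y\|_{E'}=\sup\{\int_I|xy|\,d\mu:\|x\|_E\le1\}$. $E$ is order continuous if for every $x\in E$ and every sequence $(x_n)\subset E^+$ with $x_n\le|x|$ and $x_n\to0$ a.e. one has $\|x_n\|_E\to0$. $E$ is $K$-order continuous if for every $x\in E$ and every $(x_n)\subset E$ with $x_n\prec x$ for all $n$ and $x_n^*\to0$ a.e. one has $\|x_n\|_E\to0$. $E$ is embedded in $L^1[0,\infty)$ if $E\subset L^1[0,\infty)$ and $\|x\|_{L^1}\le C\|x\|_E$ for some constant $C>0$ and all $x\in E$. *)

(* Defs.v *)
From HB Require Import structures.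
From mathcomp Require Import all_boot all_order all_algebra.
From mathcomp Require Import all_classical all_reals all_analysis.
From mathcomp Require Import measurable_realfun.

Set Implicit Arguments.
Unset Strict Implicit.
Unset Printing Implicit Defensive.

Import Order.TTheory GRing.Theory Num.Theory.
Import numFieldNormedType.Exports.

Local Open Scope classical_set_scope.
Local Open Scope ring_scope.
Local Open Scope ereal_scope.

(* An element of L^0[0, oo) is represented by a function x : R -> \bar R that
   is measurable on [0, oo); its values outside [0, oo) are irrelevant, and
   a.e. equality is handled by stating every comparison almost everywhere.
   [lebesgue_measure] lives on the Borel sets, which gives the same classes as
   Lebesgue measurability. *)

Definition halfline (R : realType) : set R := `[0%R, +oo[.
Arguments halfline R : clear implicits.

Definition ae_on_halfline (R : realType) (P : R -> Prop) : Prop :=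
  {ae lebesgue_measure, forall s : R, halfline R s -> P s}.

Definition L0 (R : realType) (x : R -> \bar R) : Prop :=
  measurable_fun (halfline R) x.

Definition distr_fun (R : realType) (x : R -> \bar R) (lam : R) : \bar R :=
  lebesgue_measure (halfline R `&` [set s | lam%:E < `|x s|]).

Definition rearr (R : realType) (x : R -> \bar R) (t : R) : \bar R :=
  ereal_inf [set lam%:E | lam in
    [set lam : R | (0 < lam)%R /\ distr_fun x lam <= t%:E]].

Definition rearr_infty (R : realType) (x : R -> \bar R) : \bar R :=
  lim (rearr x t @[t --> +oo%R]).

Definition max_rearr (R : realType) (x : R -> \bar R) (t : R) : \bar R :=
  (t^-1)%:E * \int[lebesgue_measure]_(s in `]0%R, t[) rearr x s.

Definition L1 (R : realType) (x : R -> \bar R) : Prop :=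
  (@lebesgue_measure R).-integrable (halfline R) x.

Definition Linfty (R : realType) (x : R -> \bar R) : Prop :=
  L0 x /\ exists M : R, ae_on_halfline (fun s => `|x s| <= M%:E).

Definition L1_plus_Linfty (R : realType) (x : R -> \bar R) : Prop :=
  L0 x /\ exists f g : R -> \bar R,
    [/\ L1 f, Linfty g & ae_on_halfline (fun s => x s = f s + g s)].

(* Hardy-Littlewood-Polya relation, a relation on L^1 + L^oo. *)
Definition hlp (R : realType) (x y : R -> \bar R) : Prop :=
  [/\ L1_plus_Linfty x, L1_plus_Linfty y &
      forall t : R, (0 < t)%R -> max_rearr x t <= max_rearr y t].

(* [bfs_finite] makes the pointwise vector operations on the \bar R-valued
   representatives meaningful up to a null set. The norm is only relevant on
   the carrier; by [bfs_ideal] both are invariant under a.e. equality. *)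
Record banach_function_space (R : realType) := BanachFunctionSpace {
  bfs_carrier : set (R -> \bar R) ;
  bfs_norm : (R -> \bar R) -> R ;
  bfs_measurable : forall x, bfs_carrier x -> L0 x ;
  bfs_finite : forall x, bfs_carrier x ->
    ae_on_halfline (fun s => x s \is a fin_num) ;
  bfs_add : forall x y, bfs_carrier x -> bfs_carrier y ->
    bfs_carrier (fun s => x s + y s) ;
  bfs_scale : forall (c : R) x, bfs_carrier x ->
    bfs_carrier (fun s => c%:E * x s) ;
  bfs_max : forall x y, bfs_carrier x -> bfs_carrier y ->
    bfs_carrier (fun s => maxe (x s) (y s)) ;
  bfs_norm_ge0 : forall x, bfs_carrier x -> (0 <= bfs_norm x)%R ;
  bfs_norm_eq0 : forall x, bfs_carrier x -> bfs_norm x = 0%R ->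
    ae_on_halfline (fun s => x s = 0) ;
  bfs_normZ : forall (c : R) x, bfs_carrier x ->
    bfs_norm (fun s => c%:E * x s) = (`|c| * bfs_norm x)%R ;
  bfs_normD : forall x y, bfs_carrier x -> bfs_carrier y ->
    (bfs_norm (fun s => (x s + y s)%E) <= bfs_norm x + bfs_norm y)%R ;
  bfs_complete : forall u : nat -> R -> \bar R,
    (forall n, bfs_carrier (u n)) ->
    (forall e : R, (0 < e)%R -> exists n0 : nat, forall m n : nat,
       (n0 <= m)%N -> (n0 <= n)%N ->
       (bfs_norm (fun s => (u m s - u n s)%E) < e)%R) ->
    exists2 x, bfs_carrier x &
      bfs_norm (fun s => u n s - x s) @[n --> \oo] --> 0%R ;
  bfs_ideal : forall x y, L0 x -> bfs_carrier y ->
    ae_on_halfline (fun s => `|x s| <= `|y s|) ->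
    bfs_carrier x /\ (bfs_norm x <= bfs_norm y)%R ;
  bfs_weak_unit : exists2 x, bfs_carrier x &
    ae_on_halfline (fun s => 0 < x s) }.

Definition bfs_positive (R : realType) (E : banach_function_space R)
    (x : R -> \bar R) : Prop :=
  bfs_carrier E x /\ ae_on_halfline (fun s => 0 <= x s).

Definition symmetric_space (R : realType) (E : banach_function_space R) : Prop :=
  forall x y, L0 x -> bfs_carrier E y ->
    (forall lam : R, (0 <= lam)%R -> distr_fun x lam = distr_fun y lam) ->
    bfs_carrier E x /\ bfs_norm E x = bfs_norm E y.

Definition fatou_property (R : realType) (E : banach_function_space R) : Prop :=
  forall (u : nat -> R -> \bar R) (x : R -> \bar R),
    (forall n, bfs_positive E (u n)) ->
    has_ubound (range (fun n => bfs_norm E (u n))) ->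
    L0 x ->
    ae_on_halfline (fun s => nondecreasing_seq (u ^~ s) /\
                             u n s @[n --> \oo] --> x s) ->
    [/\ bfs_carrier E x,
        nondecreasing_seq (fun n => bfs_norm E (u n)) &
        bfs_norm E (u n) @[n --> \oo] --> bfs_norm E x].

Definition fundamental_function (R : realType) (E : banach_function_space R)
    (t : R) : R :=
  bfs_norm E (fun s => (\1_(`]0%R, t[ : set R) s)%:E).

Definition fundamental_infty (R : realType) (E : banach_function_space R) :
    \bar R :=
  lim ((fundamental_function E t)%:E @[t --> +oo%R]).

Definition associate_space (R : realType) (E : banach_function_space R) :
    set (R -> \bar R) :=
  [set y | L0 y /\ forall x, bfs_carrier E x ->
     \int[lebesgue_measure]_(s in halfline R) `|x s * y s| < +oo].

Definition order_continuous (R : realType) (E : banach_function_space R) :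
    Prop :=
  forall (x : R -> \bar R) (u : nat -> R -> \bar R),
    bfs_carrier E x ->
    (forall n, bfs_positive E (u n)) ->
    (forall n, ae_on_halfline (fun s => u n s <= `|x s|)) ->
    ae_on_halfline (fun s => u n s @[n --> \oo] --> 0) ->
    bfs_norm E (u n) @[n --> \oo] --> 0%R.

Definition K_order_continuous (R : realType) (E : banach_function_space R) :
    Prop :=
  forall (x : R -> \bar R) (u : nat -> R -> \bar R),
    bfs_carrier E x ->
    (forall n, bfs_carrier E (u n)) ->
    (forall n, hlp (u n) x) ->
    ae_on_halfline (fun t => rearr (u n) t @[n --> \oo] --> 0) ->
    bfs_norm E (u n) @[n --> \oo] --> 0%R.

Definition embedded_in_L1 (R : realType) (E : banach_function_space R) : Prop :=
  bfs_carrier E `<=` @L1 R /\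
  exists2 C : R, (0 < C)%R & forall x, bfs_carrier E x ->
    \int[lebesgue_measure]_(s in halfline R) `|x s| <= (C * bfs_norm E x)%:E.

(* Main.v *)
Require Import Defs.
From mathcomp Require Import all_boot all_order all_algebra.
From mathcomp Require Import all_classical all_reals all_analysis.
From mathcomp Require Import measurable_realfun.
From mathcomp Require Import lra.

(* A symmetric space that is not embedded in L^1 has phi(t)/t -> 0, because
   (phi(a)/a) int_0^a x^* <= |x|: the average of a step function below x^* is
   dominated by a convex combination of its block permutations.  This rules out
   f in E' with f^*(oo) > 0, since f > c on a set of infinite measure forces
   phi(b) >= const * b.

   The same transfer argument on step functions shows that, under order
   continuity, int_0^t x^* <= int_0^t g for a nonincreasing g in E gives
   |x| <= 2 |g|; no duality is involved and the constant is harmless.  For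
   z < x and eta = z^*(d), a suitable g is
   x^* 1_(0,d) + eta 1_(0,K/eta) + min(x^*, x^*(M)): the outer terms are small by
   order continuity, the middle one because phi(t)/t -> 0 and eta -> 0.

   Conversely, phi(oo) = oo means that 1 is not in E, so every x in E has
   d_x finite on ]0, oo[ and dominated a.e. convergence to 0 implies convergence
   to 0 of the rearrangements; the functions 1_(0,n)/n < 1_(0,1) exclude
   L^1. *)

Set Implicit Arguments.
Unset Strict Implicit.
Unset Printing Implicit Defensive.

Import Order.TTheory GRing.Theory Num.Theory.
Import numFieldNormedType.Exports.

Local Open Scope classical_set_scope.
Local Open Scope ring_scope.

(** * Discrete majorization *)

Section majorization.
Context {R : realType}.
Implicit Types X Y Z : nat -> R.

(** Symmetry only relates equimeasurable functions, which is why majorization is reduced to finitely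
    many blocks of equal length: swapping two blocks keeps the norm, so averaging a step function
    with its swap cannot increase it. The obstacle is the origin, where x^* may be infinite. Step
    functions sample it at right ends of blocks, so the mass of a majorant near 0 is invisible to
    its samples and has to be paid for separately; this is the source of the factor 2. The cut at d
    has a similar cause: a.e. convergence of z^* to 0 makes z^* uniformly small on [d,
    oo[ but says nothing on ]0, d[, where only the comparison of integrals with x^* is available.
    The Fatou property enters twice: it bounds the functional given by f in E' on the unit ball, and
    it puts 1 in E when phi is bounded. *)

Definition swap_nat (i j k : nat) : nat :=
  if k == i then j else if k == j then i else k.

Lemma swap_natK i j : involutive (swap_nat i j).
Proof.
move=> k; rewrite /swap_nat; have [->|ki] := eqVneq k i.
  by have [->|ji] := eqVneq j i; rewrite // eqxx.
by have [->|kj] := eqVneq k j; rewrite ?eqxx// (negbTE ki) (negbTE kj).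
Qed.

Lemma sum_eq_nat (c : R) i m :
  \sum_(k < m) (c *+ (k == i :> nat)) = c *+ (i < m)%N.
Proof.
elim: m => [|m ih]; first by rewrite big_ord0.
rewrite big_ord_recr /= ih ltnS.
by case: (ltngtP i m) => _; rewrite ?mulr0n ?mulr1n ?addr0 ?add0r.
Qed.

(* Each transfer step moves mass from an index [i] where [Y] exceeds [X] to the
   first index [j] where [X] exceeds [Y]; it settles at least one of them. *)
Lemma majorization_transfer n (P : (nat -> R) -> Prop) X Y :
  (forall i j theta Z, (i < n)%N -> (j < n)%N -> 0 <= theta <= 1 ->
     P Z -> P (fun k => (1 - theta) * Z k + theta * Z (swap_nat i j k))) ->
  (forall i j, (i <= j)%N -> (j < n)%N -> X j <= X i) ->
  (forall m, (m <= n)%N -> \sum_(k < m) X k <= \sum_(k < m) Y k) ->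
  P Y -> exists2 Z, P Z & forall k, (k < n)%N -> X k <= Z k.
Proof.
move=> stepP ndX.
(* The induction is on the number of indices where [X] and the current sequence differ; settled
   indices are never disturbed again. *)
pose mis Y := [set k : 'I_n | X k != Y k]%SET.
have [c] := ubnP #|mis Y|; elim: c Y => // c ih Y misY majXY PY.
have [XY|] := pselect (forall k, (k < n)%N -> X k <= Y k); first by exists Y.
move=> /existsNP[j0 /not_implyP[j0n /negP]]; rewrite -ltNge => YXj0.
have exj : exists j, (j < n)%N && (Y j < X j) by exists j0; rewrite j0n YXj0.
case: (ex_minnP exj) => j /andP[jn YXj] minj.
have XYlt k : (k < j)%N -> X k <= Y k.
  move=> kj; rewrite leNgt; apply/negP => YXk.
  by have := minj k; rewrite YXk (ltn_trans kj jn) leqNgt kj => /(_ isT).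
(* Without such an [i], minimality of [j] would make [X] and [Y] agree below [j], and [Y j < X j]
   would break the partial sum inequality at [j.+1]. *)
have [i ij XYi] : exists2 i, (i < j)%N & X i < Y i.
  apply: contrapT => nex; have := majXY j.+1 jn; rewrite !big_ord_recr /=.
  rewrite (_ : \sum_(k < j) X k = \sum_(k < j) Y k) ?lerD2l ?leNgt ?YXj//.
  apply: eq_bigr => k _; apply/eqP; rewrite eq_le XYlt//= leNgt.
  by apply/negP => h; apply: nex; exists k.
have iltn := ltn_trans ij jn.
have Xij := ndX _ _ (ltnW ij) jn.
(* The largest transfer that overshoots neither index. Mixing with the swap in proportion [theta]
   moves [theta * (Y i - Y j)], hence the choice [theta = d / D]. *)
pose d := Num.min (Y i - X i) (X j - Y j).
have d0 : 0 < d by rewrite /d lt_min !subr_gt0 XYi YXj.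
have di : d <= Y i - X i by rewrite /d ge_min lexx.
have dj : d <= X j - Y j by rewrite /d ge_min lexx orbT.
pose D := Y i - Y j; have D0 : 0 < D by rewrite /D; lra.
pose theta := d / D.
have tD : theta * D = d by rewrite /theta mulfVK// gt_eqF.
pose Y' k := (1 - theta) * Y k + theta * Y (swap_nat i j k).
have ji : (j == i) = false by rewrite gtn_eqF.
have Y'E k : Y' k = Y k - d *+ (k == i) + d *+ (k == j).
  rewrite /Y' /swap_nat; have [->|ki] := eqVneq k i.
    by rewrite [i == j]eq_sym ji mulr1n mulr0n -tD /D; lra.
  by have [->|kj] := eqVneq k j; rewrite ?mulr1n ?mulr0n -?tD /D; lra.
apply: (ih Y') => //; last first.
- apply: stepP => //; rewrite /theta; apply/andP; split.
    by rewrite divr_ge0// ltW.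
  by rewrite ler_pdivrMr// mul1r /D; lra.
(* A partial sum changes only when it contains [i] but not [j]. It then loses [d], which the surplus
   [Y i - X i] covers, all other terms before [j] being in favour of [Y]. *)
- move=> m mn; rewrite (eq_bigr _ (fun (k : 'I_m) _ => Y'E k)) !big_split /=.
  rewrite sumrN !sum_eq_nat; have [jm|mj] := ltnP j m.
    by rewrite (ltn_trans ij jm) addrNK majXY.
  rewrite mulr0n addr0; have [im|mi] := ltnP i m; last first.
    by rewrite mulr0n subr0 majXY.
  rewrite mulr1n -subr_ge0 addrAC -sumrB subr_ge0 (bigD1 (Ordinal im))//=.
  rewrite (le_trans di)// lerDl sumr_ge0// => k _; rewrite subr_ge0.
  by rewrite XYlt// (leq_trans (ltn_ord k)).
- rewrite -ltnS (leq_trans _ misY)// ltnS proper_card//; apply/properP; split.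
    apply/fintype.subsetP => k; rewrite !inE Y'E.
    have [->|ki] := eqVneq (k : nat) i; first by move=> _; rewrite lt_eqF.
    have [->|kj] := eqVneq (k : nat) j; first by move=> _; rewrite gt_eqF.
    by rewrite !mulr0n subr0 addr0.
  have [dE|dE] : d = Y i - X i \/ d = X j - Y j.
    by rewrite /d /Num.min; case: ifP; [left|right].
  - exists (Ordinal iltn); rewrite inE /= ?(lt_eqF XYi)// Y'E eqxx.
    by rewrite [i == j]eq_sym ji mulr1n mulr0n dE negbK; apply/eqP; lra.
  - exists (Ordinal jn); rewrite inE /= ?(gt_eqF YXj)// Y'E eqxx.
    by rewrite ji mulr1n mulr0n dE negbK; apply/eqP; lra.
Qed.

End majorization.

Local Open Scope ereal_scope.

(** * Distribution functions and rearrangements *)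

Section rearrangement.
Context {R : realType}.
Notation mu := (@lebesgue_measure R).
Implicit Types x y : R -> \bar R.

Lemma measurable_halfline : measurable (halfline R).
Proof. exact: measurable_itv. Qed.
Hint Resolve measurable_halfline : core.

Lemma halflineE (s : R) : halfline R s = (0 <= s)%R.
Proof. by rewrite /halfline /= in_itv /= andbT. Qed.

(** The origin is a null set. It has to be left out because a rearrangement may be infinite
    there. *)
Lemma ae_pos (P : R -> Prop) : (forall s, (0 < s)%R -> P s) -> ae_on_halfline P.
Proof.
move=> h; exists [set 0%R]; split => //; first exact: lebesgue_measure_set1.
move=> s /= /not_implyP[]; rewrite halflineE => s0 nP.
by apply/eqP; rewrite eq_le s0 andbT leNgt; apply/negP => /h.
Qed.

Lemma aeW_halfline (P : R -> Prop) : (forall s, halfline R s -> P s) ->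
  ae_on_halfline P.
Proof. by move=> h; apply: ae_pos => s s0; apply: h; rewrite halflineE ltW. Qed.

Lemma ae_halflineS2 (P1 P2 Q : R -> Prop) :
  (forall s, (0 < s)%R -> P1 s -> P2 s -> Q s) ->
  ae_on_halfline P1 -> ae_on_halfline P2 -> ae_on_halfline Q.
Proof.
move=> h; have := ae_pos h; rewrite /ae_on_halfline.
by apply: (@filterS3 _ _ (ae_filter_ringOfSetsType mu)) => s PQ P1s P2s hs;
  exact: PQ hs (P1s hs) (P2s hs).
Qed.

(** No null set contains ]0, t[. For monotone functions one good point to the left of [t] is often
    all that an a.e. statement has to provide. *)
Lemma ae_halfline_ex (P : R -> Prop) (t : R) : (0 < t)%R -> ae_on_halfline P ->
  exists2 s, (0 < s < t)%R & P s.
Proof.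
move=> t0 [N [mN N0 PN]]; apply: contrapT => nex.
have : mu `]0%R, t[ <= mu N.
  apply: le_measure; rewrite ?inE//.
  move=> s /=; rewrite in_itv /= => /andP[s0 st]; apply: PN => /= Ps.
  apply: nex; exists s; first by rewrite s0 st.
  by apply: Ps; rewrite halflineE ltW.
by rewrite N0 lebesgue_measure_itv /= lte_fin t0 oppr0 adde0 lee_fin leNgt t0.
Qed.

Lemma measurable_distr_set x (lam : R) : L0 x ->
  measurable (halfline R `&` [set s | lam%:E < `|x s|]).
Proof.
by move=> mx; apply: emeasurable_fun_o_infty => //; exact: measurableT_comp.
Qed.
Hint Resolve measurable_distr_set : core.

Lemma le_distr x (l l' : R) : L0 x -> (l <= l')%R -> distr_fun x l' <= distr_fun x l.
Proof.
move=> mx ll'; apply: le_measure; rewrite ?inE//; try exact: measurable_distr_set.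
by move=> s [hs] /= lx; split=> //=; apply: le_lt_trans lx; rewrite lee_fin.
Qed.

Lemma le_ae_distr_fun x y (l : R) : L0 x -> L0 y ->
  ae_on_halfline (fun s => `|x s| <= `|y s|) ->
  distr_fun x l <= distr_fun y l.
Proof.
move=> mx my [N [mN N0 xyN]].
have mD := measurable_distr_set l my.
rewrite -[leRHS](_ : mu ((halfline R `&` [set s | l%:E < `|y s|]) `|` N) = _).
  apply: le_measure; rewrite ?inE//; first exact: measurable_distr_set.
    exact: measurableU.
  move=> s [hs] /= lx; have [/=|nxy] := pselect (`|x s| <= `|y s|).
    by move=> /(lt_le_trans lx) ?; left.
  by right; apply: xyN => /= h; apply: nxy; apply: h.
by rewrite measureU0.
Qed.

(** Right continuity of d_x: the level set at [l] is the increasing union of those at l + 1/(n+1),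
    and measure is continuous from below. *)
Lemma distr_right_cont x (l : R) (t : \bar R) : L0 x ->
  t < distr_fun x l -> exists2 l', (l < l')%R & t < distr_fun x l'.
Proof.
move=> mx tl.
pose F n := halfline R `&` [set s | (l + n.+1%:R^-1)%:E < `|x s|].
have mF n : measurable (F n) by exact: measurable_distr_set.
have ndF : nondecreasing_seq F.
  move=> m n mn; apply/subsetPset => s [hs] /= lx; split => //=.
  apply: le_lt_trans lx; rewrite lee_fin lerD2l lef_pV2 ?posrE//.
  by rewrite ler_nat.
have UF : \bigcup_n F n = halfline R `&` [set s | l%:E < `|x s|].
  apply/seteqP; split => [s [n _ [hs] /= lx]|s [hs] /= lx].
    by split => //=; apply: lt_trans lx; rewrite lte_fin ltrDl invr_gt0.
  have [r [lr rx]] : exists r : R, (l < r)%R /\ r%:E <= `|x s|.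
    case: (`|x s|) lx => [r| |]//.
    - by rewrite lte_fin => lr; exists r.
    - by move=> _; exists (l + 1)%R; rewrite ltrDl; split => //; rewrite leey.
  exists (Num.truncn (r - l)^-1) => //; split => //=.
  apply: lt_le_trans rx; rewrite lte_fin -ltrBrDl.
  by rewrite invf_plt ?posrE ?subr_gt0// truncnS_gt.
have cv : mu (F n) @[n --> \oo] --> distr_fun x l.
  rewrite /distr_fun -UF; apply: nondecreasing_cvg_mu => //.
  exact: bigcupT_measurable.
have [n tF] : exists n, t < mu (F n).
  apply: contrapT => /forallNP nt; move: tl; rewrite ltNge => /negP; apply.
  apply: (cvge_le _ cv); apply: nearW => n /=; rewrite leNgt; exact/negP/nt.
by exists (l + n.+1%:R^-1)%R => //; rewrite ltrDl invr_gt0.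
Qed.

Lemma rearr_ge0 x t : 0 <= rearr x t.
Proof. by apply: le_ereal_inf_tmp => _ [l [l0 _] <-]; rewrite lee_fin ltW. Qed.

(** The Galois connection between x^* and d_x, resting on right continuity of d_x. Most facts about
    rearrangements below are read off from it. *)
Lemma lt_rearr x (t l : R) : L0 x -> (0 <= l)%R ->
  (l%:E < rearr x t) = (t%:E < distr_fun x l).
Proof.
move=> mx l0; apply/idP/idP; rewrite !ltNge; apply: contra => h.
  have [lp|] := ltP 0%R l.
    by apply: ereal_inf_lbound; exists l.
  (* Level 0 is not admissible in the infimum defining [rearr], so it is approached by positive
     levels. *)
  move=> l0'; have -> : l = 0%R by apply/eqP; rewrite eq_le l0' l0.
  apply/lee_addgt0Pr => e e0; rewrite add0e; apply: ereal_inf_lbound; exists e => //.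
  by split=> //; apply: le_trans h; apply: le_distr => //; exact: le_trans (ltW e0).
rewrite leNgt; apply/negP => /(distr_right_cont mx)[l' ll' tl'].
move: h; apply/negP; rewrite -ltNge; apply: (@lt_le_trans _ _ l'%:E).
  by rewrite lte_fin.
apply: le_ereal_inf_tmp => _ [k [k0 kt] <-]; rewrite lee_fin leNgt; apply/negP => kl'.
have := lt_le_trans tl' (le_trans (le_distr mx (ltW kl')) kt).
by rewrite ltxx.
Qed.

Lemma le_rearr x (t t' : R) : (t <= t')%R -> rearr x t' <= rearr x t.
Proof.
move=> tt'; apply: le_ereal_inf => _ [l [l0 lt] <-]; exists l => //; split=> //.
by apply: le_trans lt _; rewrite lee_fin.
Qed.

Lemma le_rearr_distr x (t l : R) : (0 < l)%R -> distr_fun x l <= t%:E ->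
  rearr x t <= l%:E.
Proof. by move=> l0 h; apply: ereal_inf_lbound; exists l. Qed.

(** On ]0, oo[ the superlevel sets are intervals; adding the endpoint 0 does not affect
    measurability. *)
Lemma L0_noninc (g : R -> \bar R) :
  (forall s t, (0 < s)%R -> (s <= t)%R -> g t <= g s) -> L0 g.
Proof.
move=> ndg; rewrite /L0 /halfline.
apply/emeasurable_fun_itv_obnd_cbndP.
apply: (measurability _ (ErealGenOInfty.measurableE R)) => //.
move=> _ [_ [l ->] <-].
apply: is_interval_measurable => s t [/= + sl] [/= _ tl] u /andP[su ut].
rewrite !in_itv /= !andbT => s0; split => /=.
  by rewrite ?in_itv /= ?andbT; exact: lt_le_trans s0 su.
move: tl; rewrite /= ?in_itv /= ?andbT => tl; apply: lt_le_trans tl _.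
by apply: ndg => //; exact: lt_le_trans s0 su.
Qed.

Lemma L0_rearr x : L0 (rearr x).
Proof. by apply: L0_noninc => s t _; exact: le_rearr. Qed.

(** By [lt_rearr] the level set of x^* is the set of s >= 0 below d_x(l), an interval of that very
    length. *)
Lemma distr_rearr x (l : R) : L0 x -> (0 <= l)%R ->
  distr_fun (rearr x) l = distr_fun x l.
Proof.
move=> mx l0; rewrite {1}/distr_fun.
have -> : halfline R `&` [set s | l%:E < `|rearr x s|] =
    [set s | halfline R s /\ s%:E < distr_fun x l].
  by apply/seteqP; split => s [hs] /=; rewrite gee0_abs ?rearr_ge0// lt_rearr.
have : 0 <= distr_fun x l by [].
case: (distr_fun x l) => [d| |]//= d0.
- rewrite (_ : [set s | _] = `[0%R, d[%classic); last first.
    by apply/seteqP; split => s /=; rewrite in_itv /= halflineE lte_fin => /andP.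
  rewrite lebesgue_measure_itv /= lte_fin oppr0 adde0.
  by case: ltP => //; rewrite -lee_fin => d0'; apply/eqP; rewrite eq_le d0.
- rewrite (_ : [set s | _] = `[0%R, +oo[%classic); last first.
    by apply/seteqP; split => s /=; rewrite ?ltry// => -[].
  by rewrite lebesgue_measure_itv /= ltry.
Qed.

(** Layer cake formula: Tonelli on the region [A] under the graph, whose sections measure |x(s)| in
    one direction and d_x(l) in the other. *)
Lemma integral_distr x : L0 x ->
  \int[mu]_(s in halfline R) `|x s| = \int[mu]_(l in halfline R) distr_fun x l.
Proof.
move=> mx.
pose X := (abse \o x) \_ (halfline R).
have mX : measurable_fun setT X.
  by apply/(measurable_restrictT _ _).1 => //; apply: measurableT_comp.
pose A := [set p : R * R | (0 <= p.2)%R /\ p.2%:E < X p.1].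
have mA : measurable A.
  rewrite (_ : A = [set p | (0 <= p.2)%R] `&` [set p | p.2%:E < X p.1]); last first.
    by apply/seteqP; split.
  apply: measurableI.
    have : measurable_fun setT (fun p : R * R => (0 <= p.2)%R).
      by apply: measurable_fun_ler => //; exact: measurable_snd.
    by move=> /(_ measurableT [set true]); rewrite setTI; exact.
  have : measurable_fun setT (fun p : R * R => p.2%:E < X p.1).
    apply: measurable_fun_lte.
      by apply: measurableT_comp => //; exact: measurable_snd.
    by apply: (measurableT_comp mX); exact: measurable_fst.
  by move=> /(_ measurableT [set true]); rewrite setTI; exact.
transitivity (\int[mu]_s \int[mu]_l (\1_A (s, l))%:E).
  rewrite integral_mkcond; apply: eq_integral => s _.
  rewrite -/X.
  pose B := [set l : R | (0 <= l)%R /\ l%:E < X s].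
  have mB : measurable B.
    by have := measurable_xsection s mA; rewrite /xsection /A;
      under eq_set do rewrite inE.
  transitivity (\int[mu]_l (\1_B l)%:E).
    rewrite integral_indic// setIT /B.
    have : 0 <= X s by apply: erestrict_ge0 => u _ /=.
    case: (X s) => [d| |]//= d0.
    - rewrite (_ : [set l | _] = `[0%R, d[%classic); last first.
        by apply/seteqP; split => l /=; rewrite in_itv /= lte_fin => /andP.
      rewrite lebesgue_measure_itv /= lte_fin oppr0 adde0.
      by case: ltP => //; rewrite -lee_fin => d0'; apply/eqP; rewrite eq_le d0 d0'.
    - rewrite (_ : [set l | _] = `[0%R, +oo[%classic); last first.
        by apply/seteqP; split => l /=; rewrite in_itv /= andbT ltry; [case|].
      by rewrite lebesgue_measure_itv /= ltry.
  by [].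
transitivity (\int[mu]_l \int[mu]_s (\1_A (s, l))%:E).
  apply: (@fubini_tonelli _ _ _ _ _ mu mu (fun p => (\1_A p)%:E)).
    exact/measurable_EFinP/measurable_indic.
  by move=> p; rewrite lee_fin.
rewrite [RHS]integral_mkcond; apply: eq_integral => l _; rewrite patchE.
pose B := [set s : R | (0 <= l)%R /\ l%:E < X s].
have mB : measurable B.
  by have := measurable_ysection l mA; rewrite /ysection /A;
    under eq_set do rewrite inE.
transitivity (\int[mu]_s (\1_B s)%:E) => //.
rewrite integral_indic// setIT /B; have [l0|l0] := boolP (0 <= l)%R.
  rewrite mem_set ?halflineE//; congr (mu _); apply/seteqP; split => s /=.
    move=> [_]; rewrite /X patchE; case: ifPn => [|_]; first by rewrite inE.
    by rewrite ltNge lee_fin l0.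
  by move=> [hs lx]; split => //; rewrite /X patchE mem_set.
rewrite memNset ?halflineE//; last exact/negP.
rewrite (_ : [set s | _] = set0) ?measure0//.
by apply/seteqP; split => // s [].
Qed.

Lemma integral_rearr x : L0 x ->
  \int[mu]_(s in halfline R) `|x s| = \int[mu]_(s in halfline R) rearr x s.
Proof.
move=> mx; rewrite integral_distr//.
transitivity (\int[mu]_(s in halfline R) `|rearr x s|).
  rewrite integral_distr; last exact: L0_rearr.
  by apply: eq_integral => l; rewrite inE halflineE => l0; rewrite distr_rearr.
by apply: eq_integral => s _; rewrite gee0_abs ?rearr_ge0.
Qed.

End rearrangement.

#[local] Hint Extern 0 (measurable (halfline _)) =>
  solve [exact: measurable_halfline] : core.

(** * Indicators and the fundamental function *)

Definition chi {R : realType} (A : set R) (s : R) : \bar R := (\1_A s)%:E.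
Arguments chi : simpl never.

Section banach_function_space.
Context {R : realType}.
Notation mu := (@lebesgue_measure R).
Implicit Types (x y : R -> \bar R) (A : set R).

Lemma chi_ge0 A s : 0 <= chi A s.
Proof. by rewrite lee_fin. Qed.

Lemma L0_chi A : measurable A -> L0 (chi A).
Proof.
by move=> mA; apply/measurable_EFinP; apply: measurable_funTS; exact: measurable_indic.
Qed.

Lemma distr_chi A (l : R) : A `<=` halfline R -> (0 <= l)%R ->
  distr_fun (chi A) l = if (l < 1)%R then mu A else 0.
Proof.
move=> Ah l0; rewrite /distr_fun.
have -> : halfline R `&` [set s | l%:E < `|chi A s|] =
    if (l < 1)%R then A else set0.
  apply/seteqP; split => s.
    move=> [hs] /=; rewrite ger0_norm// indicE lte_fin.
    have [sA|sA] := boolP (s \in A); last by rewrite ltNge l0.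
    by move: sA; rewrite inE => sA ->.
  case: ifPn => // l1 As; split; first exact: Ah.
  by rewrite /= ger0_norm// indicE mem_set.
by case: ifP => //; rewrite measure0.
Qed.

Variable (E : banach_function_space R).
Notation nrm := (bfs_norm E).
Notation phi := (fundamental_function E).

Lemma bfs_carrier_le x y : L0 x -> bfs_carrier E y ->
  (forall s, (0 < s)%R -> `|x s| <= `|y s|) -> bfs_carrier E x.
Proof. by move=> mx Ey xy; apply: (proj1 (bfs_ideal mx Ey _)); exact: ae_pos. Qed.

Lemma bfs_norm_le x y : L0 x -> bfs_carrier E y ->
  (forall s, (0 < s)%R -> `|x s| <= `|y s|) -> (nrm x <= nrm y)%R.
Proof. by move=> mx Ey xy; apply: (proj2 (bfs_ideal mx Ey _)); exact: ae_pos. Qed.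

Lemma bfs_norm0 : nrm (cst 0) = 0%R.
Proof.
have [w Ew _] := bfs_weak_unit E; have := bfs_normZ 0 Ew.
rewrite normr0 mul0r => <-; congr (nrm _); apply/funext => s /=.
by rewrite mul0e.
Qed.

Lemma bfs_carrier0 : bfs_carrier E (cst 0).
Proof.
have [w Ew _] := bfs_weak_unit E; have := bfs_scale 0 Ew.
by congr bfs_carrier; apply/funext => s; rewrite mul0e.
Qed.

Lemma bfs_carrier_abs x : bfs_carrier E x -> bfs_carrier E (abse \o x).
Proof.
move=> Ex; apply: (bfs_carrier_le _ Ex); last by move=> s _ /=; rewrite abse_id.
exact: measurableT_comp (bfs_measurable Ex).
Qed.

Lemma bfs_carrier_sum (I : Type) (r : seq I) (u : I -> R -> \bar R) :
  (forall i, bfs_carrier E (u i)) ->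
  bfs_carrier E (fun s => \sum_(i <- r) u i s) /\
  (nrm (fun s => \sum_(i <- r) u i s) <= \sum_(i <- r) nrm (u i))%R.
Proof.
move=> Eu; elim: r => [|i r [Er nr]].
  rewrite big_nil [X in bfs_carrier E X](_ : _ = cst 0); last first.
    by apply/funext => s; rewrite big_nil.
  rewrite [X in nrm X](_ : _ = cst 0) ?bfs_norm0; last first.
    by apply/funext => s; rewrite big_nil.
  by split => //; exact: bfs_carrier0.
under eq_fun do rewrite big_cons; rewrite big_cons.
split; first exact: bfs_add.
by apply: (le_trans (bfs_normD (Eu i) Er)); rewrite lerD2l.
Qed.

Hypothesis E_symmetric : symmetric_space E.

Lemma bfs_carrier_equi x y : L0 x -> bfs_carrier E y ->
  (forall l, (0 <= l)%R -> distr_fun x l = distr_fun y l) -> bfs_carrier E x.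
Proof. by move=> mx Ey h; exact: (E_symmetric mx Ey h).1. Qed.

Lemma bfs_norm_equi x y : L0 x -> bfs_carrier E y ->
  (forall l, (0 <= l)%R -> distr_fun x l = distr_fun y l) -> nrm x = nrm y.
Proof. by move=> mx Ey h; exact: (E_symmetric mx Ey h).2. Qed.

Lemma bfs_carrier_rearr x : bfs_carrier E x -> bfs_carrier E (rearr x).
Proof.
move=> Ex; apply: (bfs_carrier_equi _ Ex); first exact: L0_rearr.
by move=> l l0; apply: distr_rearr => //; exact: bfs_measurable Ex.
Qed.

Lemma bfs_norm_rearr x : bfs_carrier E x -> nrm (rearr x) = nrm x.
Proof.
move=> Ex; apply: (bfs_norm_equi _ Ex); first exact: L0_rearr.
by move=> l l0; apply: distr_rearr => //; exact: bfs_measurable Ex.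
Qed.

(** An infinite value at [t] would persist on ]0, t], against a.e. finiteness. *)
Lemma fin_num_noninc_carrier g (t : R) : bfs_carrier E g -> (0 < t)%R ->
  (forall s, (0 < s)%R -> 0 <= g s) ->
  (forall s t, (0 < s)%R -> (s <= t)%R -> g t <= g s) -> g t \is a fin_num.
Proof.
move=> Eg t0 g0 ndg.
have [s /andP[s0 st] gs] := ae_halfline_ex t0 (bfs_finite Eg).
rewrite ge0_fin_numE; last exact: g0.
by apply: le_lt_trans (ndg _ _ s0 (ltW st)) _; rewrite ltey_eq gs.
Qed.

Lemma halfline_sub_itv (a b : R) : (0 <= a)%R -> `[a, b[ `<=` halfline R.
Proof. by move=> a0 s /=; rewrite halflineE in_itv /= => /andP[/(le_trans a0)]. Qed.

Lemma halfline_sub_itvo (b : R) : `]0%R, b[ `<=` halfline R.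
Proof. by move=> s /=; rewrite halflineE in_itv /= => /andP[/ltW]. Qed.
Hint Resolve halfline_sub_itvo : core.

(** The weak unit [w] is positive a.e., so for some n the bounded set where w > 1/(n+1) has positive
    measure; its indicator lies below (n+1) w. *)
Lemma ex_carrier_chi : exists A, [/\ measurable A, A `<=` halfline R,
  0 < mu A < +oo & bfs_carrier E (chi A)].
Proof.
have [w Ew w0] := bfs_weak_unit E; have mw := bfs_measurable Ew.
pose F n := (halfline R `&` [set s | n.+1%:R^-1%:E < w s]) `&` `[0%R, n%:R].
have mF n : measurable (F n).
  by apply: measurableI => //; exact: emeasurable_fun_o_infty.
have Fh n : F n `<=` halfline R by move=> s [[]].
have EF n : bfs_carrier E (chi (F n)).
  apply: (bfs_carrier_le (L0_chi (mF n)) (bfs_scale n.+1%:R Ew)) => s s0.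
  rewrite gee0_abs ?chi_ge0// /chi indicE; have [|_] := boolP (s \in F n);
    last exact: abse_ge0.
  rewrite inE => -[[hs /= ws] _]; rewrite abseM gee0_abs ?lee_fin//.
  rewrite -lee_pdivrMl// mule1; apply: le_trans (ltW ws) _.
  exact: lee_abs.
have [n Fn] : exists n, 0 < mu (F n).
  apply: contrapT => /forallNP nF.
  have F0 : {ae mu, forall s n, ~ F n s}.
    apply: ae_foralln => n; exists (F n); split; [exact: mF| |by move=> s /= /contrapT].
    by apply/eqP; rewrite eq_le measure_ge0 andbT leNgt; exact/negP/nF.
  have F0' : ae_on_halfline (fun s => forall n, ~ F n s).
    move: F0; apply: (@filterS _ _ (ae_filter_ringOfSetsType mu)) => s Fs _; exact: Fs.
  have h : ae_on_halfline (fun s => 0 < w s /\ forall n, ~ F n s).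
    by apply: ae_halflineS2 w0 F0' => s _.
  have [s /andP[s0 s1] [ws nFs]] := ae_halfline_ex ltr01 h.
  have [r [r0 rx]] : exists r : R, (0 < r)%R /\ r%:E <= w s.
    case: (w s) ws => [r| |]//.
    - by rewrite lte_fin => lr; exists r.
    - by move=> _; exists 1%R; split => //; rewrite leey.
  apply: (nFs (Num.truncn r^-1).+1); split.
    split; first by rewrite halflineE ltW.
    apply: lt_le_trans rx; rewrite lte_fin invf_plt ?posrE//.
    by apply: lt_trans (truncnS_gt _) _; rewrite ltr_nat.
  rewrite /= in_itv /= (ltW s0)/= (le_trans (ltW s1))//.
  by rewrite ler1n.
exists (F n); split => //; rewrite Fn/=.
apply: (@le_lt_trans _ _ (mu `[0%R, n%:R])).
  apply: le_measure; rewrite ?inE; [exact: mF|exact: measurable_itv|].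
  by move=> s [].
by rewrite lebesgue_measure_itv /=; case: ifP => //; rewrite oppr0 adde0 ltry.
Qed.

Lemma measure_itv_co (a b : R) : (a <= b)%R ->
  mu `[a, b[ = (b - a)%:E.
Proof.
rewrite lebesgue_measure_itv /= lte_fin le_eqVlt => /predU1P[->|ab].
  by rewrite ltxx subrr.
by rewrite ab EFinB.
Qed.

Lemma measure_itv_oo (a b : R) : (a <= b)%R ->
  mu `]a, b[ = (b - a)%:E.
Proof.
rewrite lebesgue_measure_itv /= lte_fin le_eqVlt => /predU1P[->|ab].
  by rewrite ltxx subrr.
by rewrite ab EFinB.
Qed.

(** By symmetry the set [A] of [ex_carrier_chi] can be moved onto any interval of the same length;
    finitely many such intervals cover [0, t[. *)
Lemma carrier_chi_itv (t : R) : bfs_carrier E (chi `[0%R, t[).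
Proof.
have [A [mA Ah /andP[A0 Aoo] EA]] := ex_carrier_chi.
have Afin : mu A \is a fin_num by rewrite ge0_fin_numE.
pose a := fine (mu A); have aE : mu A = a%:E by rewrite fineK.
have a0 : (0 < a)%R by rewrite -lte_fin -aE.
have Eblock n : bfs_carrier E (chi `[(n%:R * a)%R, (n.+1%:R * a)%R[).
  have h : `[(n%:R * a)%R, (n.+1%:R * a)%R[ `<=` halfline R.
    by apply: halfline_sub_itv; rewrite mulr_ge0// ltW.
  apply: (bfs_carrier_equi _ EA); first exact: L0_chi.
  move=> l l0; rewrite !distr_chi// aE measure_itv_co.
    by rewrite -mulrBl -natrB// subSnn mul1r.
  by apply: ler_wpM2r; [exact: ltW|rewrite ler_nat].
have [n nt] : exists n : nat, (t <= n%:R * a)%R.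
  by exists (Num.truncn (t / a)).+1; rewrite -ler_pdivrMr// ltW// truncnS_gt.
have En : bfs_carrier E (chi `[0%R, (n%:R * a)%R[).
  elim: n {nt} => [|n ih].
    rewrite mul0r set_itvE; have := bfs_carrier0; congr bfs_carrier.
    by apply/funext => s; rewrite /chi indicE in_set0.
  apply: (bfs_carrier_le _ (bfs_add ih (Eblock n))); first exact: L0_chi.
  move=> s s0; rewrite !gee0_abs ?adde_ge0 ?chi_ge0// /chi -EFinD lee_fin.
  rewrite !indicE !mem_setE !in_itv /= (ltW s0) /=.
  case: (ltP s (n%:R * a)%R) => _ /=; rewrite ?add0r//.
  by case: (s < _)%R; rewrite ?lerDl ?addr_ge0.
apply: (bfs_carrier_le _ En); first exact: L0_chi.
move=> s s0; rewrite !gee0_abs ?chi_ge0// /chi lee_fin.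
rewrite !indicE !mem_setE !in_itv /= (ltW s0) /= ler_nat.
by case: ltP => // st; rewrite (lt_le_trans st).
Qed.

Lemma carrier_chi_itvo (t : R) : bfs_carrier E (chi `]0%R, t[).
Proof.
apply: (bfs_carrier_le _ (carrier_chi_itv t)); first exact: L0_chi.
move=> s s0; rewrite !gee0_abs ?chi_ge0// /chi lee_fin.
by rewrite !indicE !mem_setE !in_itv /= (ltW s0) s0.
Qed.

Lemma carrier_chi A : measurable A -> A `<=` halfline R -> mu A < +oo ->
  bfs_carrier E (chi A).
Proof.
move=> mA Ah Aoo; have Afin : mu A \is a fin_num by rewrite ge0_fin_numE.
apply: (bfs_carrier_equi _ (carrier_chi_itv (fine (mu A)))); first exact: L0_chi.
move=> l l0; rewrite !distr_chi//; last exact: halfline_sub_itv.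
by rewrite measure_itv_co ?fine_ge0// subr0 fineK.
Qed.

Lemma norm_chi A : measurable A -> A `<=` halfline R -> mu A < +oo ->
  nrm (chi A) = phi (fine (mu A)).
Proof.
move=> mA Ah Aoo; have Afin : mu A \is a fin_num by rewrite ge0_fin_numE.
apply: (bfs_norm_equi _ (carrier_chi_itvo (fine (mu A)))); first exact: L0_chi.
move=> l l0; rewrite !distr_chi//.
by rewrite measure_itv_oo ?fine_ge0// subr0 fineK.
Qed.

Lemma fundamental_ge0 (t : R) : (0 <= phi t)%R.
Proof. by apply: bfs_norm_ge0; exact: carrier_chi_itvo. Qed.

Lemma le_fundamental (t t' : R) : (t <= t')%R -> (phi t <= phi t')%R.
Proof.
move=> tt'; apply: bfs_norm_le; [exact: L0_chi|exact: carrier_chi_itvo|].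
move=> s s0; rewrite !gee0_abs ?chi_ge0// lee_fin.
rewrite !indicE !mem_setE !in_itv /= s0 /= ler_nat.
by case: ltP => // st; rewrite (lt_le_trans st).
Qed.

Lemma fundamental_gt0 (t : R) : (0 < t)%R -> (0 < phi t)%R.
Proof.
move=> t0; rewrite lt_neqAle fundamental_ge0 andbT eq_sym; apply/eqP => p0.
have [s /andP[s0 st]] := ae_halfline_ex t0 (bfs_norm_eq0 (carrier_chi_itvo t) p0).
by rewrite /chi indicE mem_setE in_itv /= s0 st => -[] /eqP; rewrite oner_eq0.
Qed.

(** Triangle inequality over n adjacent intervals of length [t], all of norm [phi t] by symmetry. It
    is a cheap replacement for the quasi-concavity of [phi]. *)
Lemma fundamental_natM (n : nat) (t : R) : (0 <= t)%R ->
  (phi (n%:R * t) <= n%:R * phi t)%R.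
Proof.
move=> t0; elim: n => [|n ih].
  rewrite !mul0r /fundamental_function set_itvE.
  have -> : (fun s : R => (\1_set0 s)%:E) = cst (0 : \bar R).
    by apply/funext => s; rewrite indicE in_set0.
  by rewrite bfs_norm0.
rewrite -[in leRHS]natr1 mulrDl mul1r.
pose B := `[(n%:R * t)%R, (n.+1%:R * t)%R[%classic.
have Bh : B `<=` halfline R by apply: halfline_sub_itv; rewrite mulr_ge0.
have nt : (n%:R * t <= n.+1%:R * t)%R by rewrite ler_wpM2r// ler_nat.
have muB : mu B = t%:E.
  by rewrite /B measure_itv_co// -mulrBl -natrB// subSnn mul1r.
have Boo : mu B < +oo by rewrite muB ltry.
have phiB : phi t = nrm (chi B).
  by rewrite (norm_chi (measurable_itv _) Bh Boo) muB.
have EB : bfs_carrier E (chi B) by apply: carrier_chi => //; exact: measurable_itv.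
apply: (le_trans _ (lerD ih (lexx _))); rewrite phiB.
apply: (le_trans _ (bfs_normD (carrier_chi_itvo _) EB)).
apply: bfs_norm_le; first by apply: L0_chi; exact: measurable_itv.
  exact: bfs_add (carrier_chi_itvo _) EB.
move=> s s0; rewrite !gee0_abs ?adde_ge0 ?chi_ge0// /chi -EFinD lee_fin.
rewrite !indicE !mem_setE !in_itv /= s0 /=.
case: (ltP s (n%:R * t)%R) => _ /=; rewrite ?add0r//.
by case: (s < _)%R; rewrite ?lerDl ?addr_ge0.
Qed.

End banach_function_space.

(** * Step functions *)

Section step_functions.
Context {R : realType}.
Notation mu := (@lebesgue_measure R).
Implicit Types (a : nat -> R) (h : R).

(** The block index is obtained by truncation, so permuting blocks amounts to precomposing [a]. *)
Definition step h a (s : R) : \bar R := (a (Num.truncn (s / h)))%:E.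

Lemma truncn_block h s k : (0 < h)%R ->
  (halfline R s /\ Num.truncn (s / h) = k) <->
  `[(k%:R * h)%R, (k.+1%:R * h)%R[%classic s.
Proof.
move=> h0; rewrite halflineE /= in_itv /= -ler_pdivlMr// -ltr_pdivrMr//; split.
  by move=> [s0 <-]; apply: truncn_itv; rewrite divr_ge0// ltW.
move=> sk; split; last exact: truncn_def.
have : (0 <= s / h)%R by case/andP: sk => + _; apply: le_trans.
by rewrite pmulr_lge0// invr_gt0.
Qed.

Lemma block_preimageE h (D : set nat) : (0 < h)%R ->
  halfline R `&` [set s | D (Num.truncn (s / h))] =
  \bigcup_(k in D) `[(k%:R * h)%R, (k.+1%:R * h)%R[%classic.
Proof.
move=> h0; apply/seteqP; split => [s [hs Ds]|s [k Dk /(truncn_block _ _ h0)[hs sk]]].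
  by exists (Num.truncn (s / h)) => //; apply/(truncn_block _ _ h0).
by split => //=; rewrite sk.
Qed.

(** Writing the measure as a sum over indices turns invariance under block permutations into a
    reindexing. *)
Lemma measure_block_preimage h (D : set nat) : (0 < h)%R ->
  mu (halfline R `&` [set s | D (Num.truncn (s / h))]) = \esum_(k in D) h%:E.
Proof.
move=> h0; rewrite block_preimageE// measure_bigcup; last 2 first.
- by move=> k _; exact: measurable_itv.
- move=> i j _ _ [s [/(truncn_block _ _ h0)[_ <-] /(truncn_block _ _ h0)[_ <-]]].
  by [].
rewrite nneseries_esum// set_mem_set; apply: eq_esum => k _.
transitivity (mu `[(k%:R * h)%R, (k.+1%:R * h)%R[) => //.
rewrite measure_itv_co; last by rewrite ler_wpM2r ?(ltW h0)// ler_nat.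
by rewrite -mulrBl -natrB// subSnn mul1r.
Qed.

Lemma L0_step h a : (0 < h)%R -> L0 (step h a).
Proof.
move=> h0 _ Y mY.
rewrite (_ : _ `&` _ = halfline R `&`
    [set s | [set k | Y (a k)%:E] (Num.truncn (s / h))])//.
by rewrite block_preimageE//; apply: bigcup_measurable => k _; exact: measurable_itv.
Qed.

Lemma distr_step_perm h a (f : nat -> nat) l : (0 < h)%R -> involutive f ->
  distr_fun (step h (a \o f)) l = distr_fun (step h a) l.
Proof.
move=> h0 fK; rewrite /distr_fun.
rewrite (measure_block_preimage [set k | l%:E < `|(a (f k))%:E|])//.
rewrite (measure_block_preimage [set k | l%:E < `|(a k)%:E|])//.
apply/esym; apply: (reindex_esum _ _ f); split.
- by move=> k /=.
- by move=> i j _ _; exact: (can_inj fK).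
- by move=> k /= lk; exists (f k) => /=; rewrite fK.
Qed.

Variable E : banach_function_space R.
Notation nrm := (bfs_norm E).
Notation phi := (fundamental_function E).
Hypothesis E_symmetric : symmetric_space E.

Lemma carrier_step h a n : (0 < h)%R -> (forall k, (n <= k)%N -> a k = 0%R) ->
  bfs_carrier E (step h a).
Proof.
move=> h0 an; pose M := (\sum_(k < n) `|a k|)%R.
apply: (bfs_carrier_le (L0_step _ h0)
  (bfs_scale M (carrier_chi_itv E_symmetric (n%:R * h)))) => s s0.
rewrite /step /chi indicE mem_setE in_itv /= (ltW s0) /= -ltr_pdivrMr//.
rewrite -truncn_lt_nat; last by rewrite divr_ge0// ltW.
set k := Num.truncn _; have [kn|nk] := ltnP k n; last by rewrite an// normr0 lee_fin.
rewrite mulr1 lee_fin (ger0_norm (sumr_ge0 _ _))// /M.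
by rewrite (bigD1 (Ordinal kn))//= lerDl sumr_ge0.
Qed.

(** The sequences [Z] with step function in the ball of radius [nrm (step h Y)] are closed under
    transfers, by convexity of the norm and symmetry. [majorization_transfer] then finds one of them
    above [X]. *)
Lemma norm_step_le h n (X Y : nat -> R) : (0 < h)%R ->
  (forall k, (n <= k)%N -> X k = 0%R) -> (forall k, (n <= k)%N -> Y k = 0%R) ->
  (forall k, (0 <= X k)%R) ->
  (forall i j, (i <= j)%N -> (j < n)%N -> (X j <= X i)%R) ->
  (forall m, (m <= n)%N -> (\sum_(k < m) X k <= \sum_(k < m) Y k)%R) ->
  (nrm (step h X) <= nrm (step h Y))%R.
Proof.
move=> h0 Xn Yn X0 ndX XY.
pose P Z := bfs_carrier E (step h Z) /\ (nrm (step h Z) <= nrm (step h Y))%R.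
have PY : P Y by split => //; exact: carrier_step Yn.
have [i j theta Z _ _ /andP[t0 t1] [EZ nZ]|Z [EZ nZ] XZ] :=
    majorization_transfer (P := P) _ ndX XY PY; last first.
  apply: le_trans nZ; apply: bfs_norm_le => //; first exact: L0_step.
  move=> s s0; rewrite /step !abse_EFin lee_fin.
  set k := Num.truncn _; have [kn|nk] := ltnP k n; last by rewrite Xn// normr0.
  by rewrite (ger0_norm (X0 _)) (le_trans (XZ _ kn))// ler_norm.
have dE l : (0 <= l)%R -> distr_fun (step h (Z \o swap_nat i j)) l =
  distr_fun (step h Z) l.
  by move=> _; apply: distr_step_perm => //; exact: swap_natK.
have mZ' := L0_step (Z \o swap_nat i j) h0.
have EZ' := bfs_carrier_equi E_symmetric mZ' EZ dE.
have nZ' := bfs_norm_equi E_symmetric mZ' EZ dE.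
rewrite /P (_ : step h (fun k => (1 - theta) * Z k + theta * Z (swap_nat i j k))%R =
    (fun s => (1 - theta)%:E * step h Z s + theta%:E * step h (Z \o swap_nat i j) s))//.
have E1 := bfs_scale (1 - theta) EZ; have E2 := bfs_scale theta EZ'.
split; first exact: bfs_add.
apply: (le_trans (bfs_normD E1 E2)); rewrite !bfs_normZ// nZ' -mulrDl.
by rewrite !ger0_norm ?subr_ge0// subrK mul1r.
Qed.

End step_functions.

(** * Riemann sums of nonincreasing functions *)

Section averages.
Context {R : realType}.
Notation mu := (@lebesgue_measure R).

Section noninc.
Variable g : R -> \bar R.
Hypothesis g_ge0 : forall s, (0 < s)%R -> 0 <= g s.
Hypothesis g_noninc : forall s t, (0 < s)%R -> (s <= t)%R -> g t <= g s.

Lemma measurable_noninc (A : set R) : measurable A -> A `<=` halfline R ->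
  measurable_fun A g.
Proof. by move=> mA Ah; apply: (measurable_funS _ Ah (L0_noninc g_noninc)). Qed.

Lemma integral_cst_co (a b : R) (c : \bar R) : (a <= b)%R ->
  \int[mu]_(x in `[a, b[) (cst c) x = (b - a)%:E * c.
Proof.
by move=> ab; rewrite integral_cst// muleC; congr (_ * c); exact: measure_itv_co.
Qed.

Lemma integral_cst_oo (a b : R) (c : \bar R) : (a <= b)%R ->
  \int[mu]_(x in `]a, b[) (cst c) x = (b - a)%:E * c.
Proof.
by move=> ab; rewrite integral_cst// muleC; congr (_ * c); exact: measure_itv_oo.
Qed.

Lemma riemann_lower (h : R) m : (0 < h)%R ->
  \sum_(k < m) h%:E * g (k.+1%:R * h) <= \int[mu]_(s in `]0%R, (m%:R * h)%R[) g s.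
Proof.
move=> h0; elim: m => [|m ih].
  by rewrite big_ord0; apply: integral_ge0 => s /=; rewrite in_itv /= => /andP[/g_ge0].
have mh : (m%:R * h <= m.+1%:R * h)%R by rewrite ler_wpM2r ?(ltW h0)// ler_nat.
have m0 : (0 <= m%:R * h)%R by rewrite mulr_ge0// ltW.
have subh : `]0%R, (m.+1%:R * h)%R[ `<=` halfline R by exact: halfline_sub_itvo.
have sub : `]0%R, (m%:R * h)%R[ `|` `](m%:R * h)%R, (m.+1%:R * h)%R[ `<=`
    `]0%R, (m.+1%:R * h)%R[.
  move=> s /= []; rewrite !in_itv /= => /andP[s1 s2].
    by rewrite s1 (lt_le_trans s2).
  by rewrite s2 (le_lt_trans _ s1).
have mg : measurable_fun `]0%R, (m.+1%:R * h)%R[ g by exact: measurable_noninc.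
have g0 s : `]0%R, (m.+1%:R * h)%R[%classic s -> 0 <= g s.
  by rewrite /= in_itv /= => /andP[/g_ge0].
rewrite big_ord_recr /=.
apply: (@le_trans _ _ (\int[mu]_(s in `]0%R, (m%:R * h)%R[ `|`
    `](m%:R * h)%R, (m.+1%:R * h)%R[) g s)); last first.
  by apply: ge0_subset_integral => //; exact: measurableU.
rewrite ge0_integral_setU//; last 3 first.
- by apply: measurable_funS mg.
- by move=> s /sub/g0.
- apply/disj_setPLR => s /= ; rewrite !in_itv /= => /andP[_ s1]; apply/negP.
  by rewrite negb_and -!leNgt (ltW s1).
apply: leeD => //.
have -> : h%:E * g (m.+1%:R * h) =
    \int[mu]_(x in `](m%:R * h)%R, (m.+1%:R * h)%R[) (cst (g (m.+1%:R * h))) x.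
  rewrite integral_cst_oo//.
  by rewrite -mulrBl -natrB// subSnn mul1r.
apply: ge0_le_integral => //.
- by move=> s _; apply: g_ge0; rewrite mulr_gt0.
- by apply: measurable_funS mg => // s ?; apply: sub; right.
- move=> s /=; rewrite in_itv /= => /andP[s1 s2].
  by apply: g_noninc; [exact: le_lt_trans s1|exact: ltW].
Qed.

(** The samples of [riemann_lower] reappear as left-end values of the blocks shifted by one. The
    block next to 0 is left out because [g] may be unbounded there. *)
Lemma riemann_upper (h : R) m : (0 < h)%R ->
  \int[mu]_(s in `[h, (m.+1%:R * h)%R[) g s <= \sum_(k < m) h%:E * g (k.+1%:R * h).
Proof.
move=> h0; elim: m => [|m ih].
  by rewrite mul1r set_itvE integral_set0 big_ord0.
have mh : (m.+1%:R * h <= m.+2%:R * h)%R by rewrite ler_wpM2r ?(ltW h0)// ler_nat.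
have hm : (h <= m.+1%:R * h)%R by rewrite ler_peMl ?(ltW h0)// ler1n.
have m0 : (0 < m.+1%:R * h)%R by rewrite mulr_gt0.
have UE : `[h, (m.+2%:R * h)%R[%classic = `[h, (m.+1%:R * h)%R[%classic `|`
    `[(m.+1%:R * h)%R, (m.+2%:R * h)%R[%classic.
  by apply: itv_bndbnd_setU; rewrite bnd_simp.
have mg : measurable_fun `[h, (m.+2%:R * h)%R[ g.
  by apply: measurable_noninc => //; apply: halfline_sub_itv; rewrite ltW.
have sub : `[(m.+1%:R * h)%R, (m.+2%:R * h)%R[ `<=` `[h, (m.+2%:R * h)%R[.
  by rewrite UE; right.
have g0 s : `[h, (m.+2%:R * h)%R[%classic s -> 0 <= g s.
  by rewrite /= in_itv /= => /andP[/(lt_le_trans h0)/g_ge0].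
rewrite big_ord_recr /= UE ge0_integral_setU// -?UE//; last first.
  apply/disj_setPLR => s /= ; rewrite !in_itv /= => /andP[_ s1]; apply/negP.
  by rewrite negb_and -!ltNge s1.
apply: leeD => //.
have -> : h%:E * g (m.+1%:R * h) =
    \int[mu]_(x in `[(m.+1%:R * h)%R, (m.+2%:R * h)%R[) (cst (g (m.+1%:R * h))) x.
  rewrite integral_cst_co//.
  by rewrite -mulrBl -natrB// subSnn mul1r.
apply: ge0_le_integral => //.
- by move=> s /sub/g0.
- by apply: measurable_funS mg.
- move=> s /=; rewrite in_itv /= => /andP[s1 s2].
  by apply: g_noninc.
Qed.

End noninc.

End averages.

(** * Averages of nonincreasing functions *)

Lemma ereal_cvg0 {R : realType} (u : nat -> \bar R) : (forall n, 0 <= u n) ->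
  (forall e : R, (0 < e)%R -> \forall n \near \oo, u n <= e%:E) ->
  u n @[n --> \oo] --> 0.
Proof.
move=> u0 ue; apply/fine_cvgP; split.
  near=> n; rewrite ge0_fin_numE//; apply: (@le_lt_trans _ _ 1%:E); last exact: ltry.
  by near: n; exact: ue.
apply/cvgrPdist_le => e e0; near=> n.
rewrite sub0r normrN /= ger0_norm ?fine_ge0// -lee_fin fineK; last first.
  rewrite ge0_fin_numE//; apply: (@le_lt_trans _ _ e%:E); last exact: ltry.
  by near: n; exact: ue.
by near: n; exact: ue.
Unshelve. all: by end_near. Qed.

(** Monotonicity of means with denominators cleared. It says that the constant sequence equal to the
    mean of [Y] is majorized by [Y]. *)
Lemma sum_noninc_mean {R : realType} (Y : nat -> R) m n :
  (forall i j, (i <= j)%N -> (j < n)%N -> (Y j <= Y i)%R) -> (m <= n)%N ->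
  (m%:R * (\sum_(k < n) Y k) <= n%:R * \sum_(k < m) Y k)%R.
Proof.
elim: n => [|n ih] ndY; first by rewrite leqn0 => /eqP->.
rewrite leq_eqVlt => /predU1P[->//|]; rewrite ltnS => mn.
rewrite big_ord_recr /= -[in leRHS]natr1 mulrDr mulrDl mul1r lerD//.
  by apply: ih => // i j ij jn; apply: ndY => //; exact: leqW.
have -> : (m%:R * Y n = \sum_(k < m) Y n)%R.
  by rewrite sumr_const card_ord mulr_natl.
rewrite ler_sum// => k _.
by apply: ndY => //; rewrite ltnW// (leq_trans (ltn_ord k)).
Qed.

Section averages.
Context {R : realType}.
Notation mu := (@lebesgue_measure R).

(** Right-end samples are finite and lie below a nonincreasing [g] in [E]; the cutoff after [m]
    blocks keeps the step function in [E] by boundedness alone. *)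
Definition lower_seq (g : R -> \bar R) (h : R) (m k : nat) : R :=
  if (k < m)%N then fine (g (k.+1%:R * h)%R) else 0%R.

Lemma lower_seq_ge (g : R -> \bar R) (h : R) m k : (m <= k)%N ->
  lower_seq g h m k = 0%R.
Proof. by rewrite /lower_seq ltnNge => ->. Qed.

Variable E : banach_function_space R.
Notation nrm := (bfs_norm E).
Notation phi := (fundamental_function E).
Hypothesis E_symmetric : symmetric_space E.

Section noninc.
Variable g : R -> \bar R.
Hypothesis g_ge0 : forall s, (0 < s)%R -> 0 <= g s.
Hypothesis g_noninc : forall s t, (0 < s)%R -> (s <= t)%R -> g t <= g s.
Hypothesis Eg : bfs_carrier E g.

Lemma noninc_fin s : (0 < s)%R -> g s \is a fin_num.
Proof. by move=> s0; exact: fin_num_noninc_carrier Eg s0 g_ge0 g_noninc. Qed.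

Lemma lower_seq_ge0 h m k : (0 < h)%R -> (0 <= lower_seq g h m k)%R.
Proof.
by move=> h0; rewrite /lower_seq; case: ifP => // _;
  rewrite fine_ge0// g_ge0// mulr_gt0.
Qed.

Lemma lower_seq_noninc h m i j : (0 < h)%R -> (i <= j)%N -> (j < m)%N ->
  (lower_seq g h m j <= lower_seq g h m i)%R.
Proof.
move=> h0 ij jm; rewrite /lower_seq jm (leq_ltn_trans ij jm).
rewrite fine_le ?noninc_fin ?mulr_gt0// g_noninc ?mulr_gt0//.
by rewrite ler_wpM2r ?(ltW h0)// ler_nat.
Qed.

Lemma sum_lower_seq h m n : (0 < h)%R -> (n <= m)%N ->
  \sum_(k < n) h%:E * g (k.+1%:R * h) = (h * \sum_(k < n) lower_seq g h m k)%:E.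
Proof.
move=> h0 nm; rewrite mulr_sumr -sumEFin; apply: eq_bigr => k _.
by rewrite /lower_seq (leq_trans (ltn_ord k) nm) EFinM fineK// noninc_fin// mulr_gt0.
Qed.

Lemma step_lower_seq_ge0 h m s : (0 < h)%R -> 0 <= step h (lower_seq g h m) s.
Proof. by move=> h0; rewrite lee_fin lower_seq_ge0. Qed.

Lemma step_lower_seq_le h m s : (0 < h)%R -> (0 < s)%R ->
  step h (lower_seq g h m) s <= g s.
Proof.
move=> h0 s0; rewrite /step /lower_seq; case: ifP => _; last exact: g_ge0.
rewrite fineK ?noninc_fin ?mulr_gt0// g_noninc// -ler_pdivrMr//.
by rewrite ltW// truncnS_gt.
Qed.

Lemma carrier_step_lower_seq h m : (0 < h)%R ->
  bfs_carrier E (step h (lower_seq g h m)).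
Proof. by move=> h0; apply: (carrier_step _ (n := m)) => // k; exact: lower_seq_ge. Qed.

Lemma norm_step_lower_seq h m : (0 < h)%R ->
  (nrm (step h (lower_seq g h m)) <= nrm g)%R.
Proof.
move=> h0; apply: bfs_norm_le => //; first exact: L0_step.
move=> s s0; rewrite gee0_abs ?step_lower_seq_ge0// gee0_abs ?g_ge0//.
exact: step_lower_seq_le.
Qed.

Lemma average_bound (a : R) : (0 < a)%R ->
  (phi a)%:E * \int[mu]_(s in `]0%R, a[) g s <= (a * nrm g)%:E.
Proof.
(* [riemann_upper] reaches down only to the first mesh point, so the bound is proved on these
   intervals and monotone convergence recovers ]0, a[. *)
move=> a0; pose F n := `[(a / n.+1%:R)%R, a[%classic.
have an0 n : (0 < a / n.+1%:R)%R by rewrite divr_gt0.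
have Fh n : F n `<=` halfline R by apply: halfline_sub_itv; rewrite ltW.
have UF : \bigcup_n F n = `]0%R, a[%classic.
  apply/seteqP; split => [s [n _]|s]; rewrite /F /= !in_itv /= => /andP[s1 s2].
    by rewrite s2 (lt_le_trans (an0 n) s1).
  exists (Num.truncn (a / s)) => //=; rewrite in_itv /= s2 andbT.
  by rewrite ler_pdivrMr// mulrC -ler_pdivrMr// ltW// truncnS_gt.
have step_bound n : (phi a)%:E * \int[mu]_(s in F n) g s <= (a * nrm g)%:E.
  pose h := (a / n.+1%:R)%R; have h0 : (0 < h)%R by exact: an0.
  have ah : (n.+1%:R * h = a)%R by rewrite /h mulrCA divff ?mulr1.
  pose Y := lower_seq g h n.+1.
  pose c := ((\sum_(k < n.+1) Y k) / n.+1%:R)%R.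
  pose X k : R := if (k < n.+1)%N then c else 0%R.
  have c0 : (0 <= c)%R by rewrite divr_ge0// sumr_ge0// => k _; exact: lower_seq_ge0.
  have sXE m : (m <= n.+1)%N -> (\sum_(k < m) X k = m%:R * c)%R.
    move=> mn; rewrite (eq_bigr (fun=> c)); last first.
      by move=> k _; rewrite /X (leq_trans (ltn_ord k)).
    by rewrite sumr_const card_ord mulr_natl.
  have XY : (nrm (step h X) <= nrm (step h Y))%R.
    apply: (norm_step_le E_symmetric (n := n.+1)) => //.
    - by move=> k nk; rewrite /X ltnS leqNgt nk.
    - by move=> k; exact: lower_seq_ge.
    - by move=> k; rewrite /X; case: ifP.
    - by move=> i j ij jn; rewrite /X jn (leq_ltn_trans ij jn).
    - move=> m mn; rewrite sXE// /c mulrA ler_pdivrMr// [leRHS]mulrC.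
      by apply: sum_noninc_mean => // i j ij jn; exact: lower_seq_noninc.
  have cX : (c * phi a <= nrm (step h X))%R.
    have Echi := carrier_chi_itvo E_symmetric a.
    have -> : (c * phi a)%R = nrm (fun s => c%:E * chi `]0%R, a[ s).
      by rewrite bfs_normZ// ger0_norm.
    apply: bfs_norm_le.
    - exact: bfs_measurable (bfs_scale c Echi).
    - by apply: (carrier_step _ (n := n.+1)) => // k nk; rewrite /X ltnS leqNgt nk.
    - move=> s s0; rewrite /chi /step -EFinM !abse_EFin lee_fin indicE mem_setE
        in_itv /= s0 /=.
      rewrite -{1}ah -ltr_pdivrMr// -truncn_lt_nat; last by rewrite divr_ge0// ltW.
      rewrite /X; by case: ifP; rewrite ?mulr1 ?mulr0.
  (* The upper sum over [F n] has n terms whereas [c] averages n+1 of them; the extra last term is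
     nonnegative. *)
  have intY : \int[mu]_(s in F n) g s <= (a * c)%:E.
    rewrite /F -/h -{1}ah; apply: (le_trans (riemann_upper g_ge0 g_noninc n h0)).
    rewrite (sum_lower_seq (m := n.+1))// lee_fin.
    have -> : (a * c = h * \sum_(k < n.+1) Y k)%R.
      by rewrite -[in LHS]ah [(_ * h)%R]mulrC -mulrA; congr (_ * _)%R;
        rewrite /c mulrC divfK.
    rewrite ler_wpM2l ?(ltW h0)// big_ord_recr /= lerDl.
    exact: lower_seq_ge0.
  apply: (@le_trans _ _ ((phi a)%:E * (a * c)%:E)).
    by apply: lee_wpmul2l => //; rewrite lee_fin fundamental_ge0.
  rewrite -EFinM lee_fin mulrCA ler_wpM2l ?(ltW a0)// mulrC.
  exact: le_trans cX (le_trans XY (norm_step_lower_seq _ h0)).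
have cv : \int[mu]_(s in F n) g s @[n --> \oo] --> \int[mu]_(s in `]0%R, a[) g s.
  rewrite -UF; apply: ge0_nondecreasing_set_cvg_integral.
  - move=> m n mn; apply/subsetPset => s; rewrite /F /= !in_itv /= => /andP[s1 ->].
    rewrite andbT (le_trans _ s1)// ler_pM2l// lef_pV2 ?posrE//.
    by rewrite ler_nat.
  - by move=> n; exact: measurable_itv.
  - by move=> n; apply: (measurable_noninc g_noninc) => //; exact: measurable_itv.
  - by move=> n s; rewrite /F /= in_itv /= => /andP[/(lt_le_trans (an0 n))/g_ge0].
apply: (cvge_le _ (cvgeZl (y := (phi a)%:E) _ cv)) => //.
exact: nearW.
Qed.

Lemma integral_itvo_lty (a : R) : (0 < a)%R ->
  \int[mu]_(s in `]0%R, a[) g s < +oo.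
Proof.
move=> a0; have := average_bound a0.
rewrite -lee_pdivlMl ?fundamental_gt0// => h.
by apply: (le_lt_trans h); rewrite -EFinM ltry.
Qed.

End noninc.

End averages.

(** * Norm of majorized functions *)

Section hardy_littlewood_polya.
Context {R : realType}.
Notation mu := (@lebesgue_measure R).
Variable E : banach_function_space R.
Notation nrm := (bfs_norm E).
Notation phi := (fundamental_function E).
Hypothesis E_symmetric : symmetric_space E.

(** By [lt_rearr] the assumption reads t < d_x(c), an open condition on [t]. This is what makes
    right-end samples converge to x^* at every point. *)
Lemma rearr_right_lsc (x : R -> \bar R) (c t : R) : L0 x -> (0 <= c)%R ->
  c%:E < rearr x t -> exists2 d, (0 < d)%R &
    forall s, (s < t + d)%R -> c%:E < rearr x s.
Proof.
move=> mx c0; rewrite lt_rearr// => td.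
have [d d0 tdE] : exists2 d, (0 < d)%R & (t + d)%:E <= distr_fun x c.
  case: (distr_fun x c) td => [r| |]//; first rewrite lte_fin => tr.
    by exists (r - t)%R; rewrite ?subr_gt0// lee_fin addrCA subrr addr0.
  by exists 1%R => //; exact: leey.
exists d => // s st; rewrite lt_rearr//; apply: lt_le_trans tdE.
by rewrite lte_fin.
Qed.

Section majorized.
Variables f g : R -> \bar R.
Hypothesis f_ge0 : forall s, (0 < s)%R -> 0 <= f s.
Hypothesis f_noninc : forall s t, (0 < s)%R -> (s <= t)%R -> f t <= f s.
Hypothesis Ef : bfs_carrier E f.
Hypothesis g_ge0 : forall s, (0 < s)%R -> 0 <= g s.
Hypothesis g_noninc : forall s t, (0 < s)%R -> (s <= t)%R -> g t <= g s.
Hypothesis Eg : bfs_carrier E g.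
Hypothesis fg : forall t, (0 < t)%R ->
  \int[mu]_(s in `]0%R, t[) f s <= \int[mu]_(s in `]0%R, t[) g s.

(** Samples of [g] at h, 2h, ... account only for its integral from [h] on. The missing mass over
    ]0, h[ is added as height on the first block, and its norm is bounded by a second copy of
    [nrm g]. *)
Lemma norm_step_majorized h n : (0 < h)%R ->
  (nrm (step h (lower_seq f h n)) <= nrm g + nrm g)%R.
Proof.
move=> h0; case: n => [|n].
  rewrite (_ : step h _ = cst 0); last by [].
  by rewrite bfs_norm0 addr_ge0// bfs_norm_ge0.
pose I := \int[mu]_(s in `]0%R, h[) g s.
have I0 : 0 <= I by apply: integral_ge0 => s /=; rewrite in_itv /= => /andP[/g_ge0].
have Ifin : I \is a fin_num.
  by rewrite ge0_fin_numE// (integral_itvo_lty E_symmetric g_ge0 g_noninc Eg h0).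
(* The mean of [g] over ]0, h[, so that a block of height [e] and length [h] carries the mass
   [I]. *)
pose e := (fine I / h)%R.
have e0 : (0 <= e)%R by rewrite divr_ge0 ?fine_ge0// ltW.
have he : I = (h * e)%:E by rewrite /e mulrC divfK ?gt_eqF// fineK.
pose Y0 := lower_seq g h n.+1.
pose e1 (k : nat) := (e *+ (k == 0%N))%R.
pose Y k := (Y0 k + e1 k)%R.
have Y00 k : (0 <= Y0 k)%R by exact: lower_seq_ge0.
have e1n k : (1 <= k)%N -> e1 k = 0%R by case: k.
have XY : (nrm (step h (lower_seq f h n.+1)) <= nrm (step h Y))%R.
  apply: (norm_step_le E_symmetric (n := n.+1)) => //.
  - by move=> k; exact: lower_seq_ge.
  - by move=> k nk; rewrite /Y /Y0 lower_seq_ge// e1n ?addr0// (leq_ltn_trans _ nk).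
  - by move=> k; exact: lower_seq_ge0.
  - by move=> i j ij jn; exact: (lower_seq_noninc f_ge0 f_noninc Ef).
  - case=> [|m] mn; first by rewrite !big_ord0.
    have mh0 : (0 < m.+1%:R * h)%R by rewrite mulr_gt0.
    rewrite -(ler_pM2l h0) -lee_fin -(sum_lower_seq f_ge0 f_noninc Ef)//.
    apply: (le_trans (riemann_lower f_ge0 f_noninc _ h0)).
    apply: (le_trans (fg mh0)).
    apply: (@le_trans _ _ (I + \int[mu]_(s in `[h, (m.+1%:R * h)%R[) g s)).
      have hm : (h <= m.+1%:R * h)%R by rewrite ler_peMl ?(ltW h0)// ler1n.
      rewrite /I -ge0_integral_setU//=.
      - rewrite (_ : `]0%R, h[%classic `|` _ = `]0%R, (m.+1%:R * h)%R[%classic)//.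
        by apply/esym/itv_bndbnd_setU; rewrite bnd_simp.
      - rewrite (_ : `]0%R, h[%classic `|` _ = `]0%R, (m.+1%:R * h)%R[%classic).
          by apply: (measurable_noninc g_noninc) => //; exact: halfline_sub_itvo.
        by apply/esym/itv_bndbnd_setU; rewrite bnd_simp.
      - move=> s [|]; rewrite /= in_itv /= => /andP[s0 _]; first exact: g_ge0.
        by apply: g_ge0; exact: lt_le_trans s0.
      - apply/disj_setPLR => s /= ; rewrite !in_itv /= => /andP[_ s1]; apply/negP.
        by rewrite negb_and -!ltNge s1.
    rewrite big_split /= mulrDr EFinD addeC; apply: leeD; last first.
      apply: (le_trans (riemann_upper g_ge0 g_noninc _ h0)).
      rewrite (sum_lower_seq g_ge0 g_noninc Eg (m := n.+1))//; last exact: ltnW.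
      by rewrite lee_fin ler_pM2l// big_ord_recr /= lerDl.
    rewrite he lee_fin ler_pM2l// big_ord_recl /= /e1 eqxx mulr1n lerDl.
    by rewrite sumr_ge0// => k _; rewrite mulrn_wge0.
apply: (le_trans XY).
have E0 := carrier_step_lower_seq E_symmetric g n.+1 h0.
have E1 : bfs_carrier E (step h e1) by exact: carrier_step e1n.
rewrite (_ : step h Y = (fun s => step h Y0 s + step h e1 s))//.
apply: (le_trans (bfs_normD E0 E1)); apply: lerD.
  exact: (norm_step_lower_seq g_ge0 g_noninc Eg _ h0).
have Ech := carrier_chi_itv E_symmetric h.
apply: (@le_trans _ _ (nrm (fun s => e%:E * chi `[0%R, h[ s))).
  apply: bfs_norm_le; [exact: L0_step|exact: bfs_scale|].
  move=> s s0; rewrite /chi /step -EFinM !abse_EFin lee_fin indicE mem_setE in_itv /=.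
  rewrite (ltW s0)/= /e1 -leqn0 -ltnS truncn_lt_nat; last by rewrite divr_ge0// ltW.
  by rewrite ltr_pdivrMr// mul1r mulr_natr.
rewrite bfs_normZ// ger0_norm// norm_chi//; last 2 first.
- exact: halfline_sub_itv.
- by rewrite measure_itv_co ?ltry// ltW.
rewrite measure_itv_co ?(ltW h0)//= subr0 /e.
(* The first block has norm [e * phi h], that is phi(h)/h times the integral of [g] over ]0, h[,
   which is what [average_bound] controls. *)
have := average_bound E_symmetric g_ge0 g_noninc Eg h0.
rewrite -/I -(fineK Ifin) -EFinM lee_fin => H.
by rewrite mulrAC ler_pdivrMr// mulrC [leRHS]mulrC.
Qed.

End majorized.

Hypothesis E_oc : order_continuous E.

Lemma norm_majorized x g : bfs_carrier E x ->
  (forall s, (0 < s)%R -> 0 <= g s) ->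
  (forall s t, (0 < s)%R -> (s <= t)%R -> g t <= g s) -> bfs_carrier E g ->
  (forall t, (0 < t)%R ->
     \int[mu]_(s in `]0%R, t[) rearr x s <= \int[mu]_(s in `]0%R, t[) g s) ->
  (nrm x <= nrm g + nrm g)%R.
Proof.
move=> Ex g0 ndg Eg xg; rewrite -(bfs_norm_rearr E_symmetric Ex).
have Ef := bfs_carrier_rearr E_symmetric Ex.
pose f := rearr x; have mx := bfs_measurable Ex.
have f0 s : (0 < s)%R -> 0 <= f s by move=> _; exact: rearr_ge0.
have ndf s t : (0 < s)%R -> (s <= t)%R -> f t <= f s by move=> _; exact: le_rearr.
pose h (j : nat) : R := (j.+1%:R^-1)%R.
have h0 j : (0 < h j)%R by rewrite invr_gt0.
(* (j+1)^2 blocks of length 1/(j+1) cover [0, j+1[: the mesh shrinks while the support exhausts the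
   half-line. *)
pose v j := step (h j) (lower_seq f (h j) (j.+1 * j.+1)).
pose u j s := f s + (-1)%:E * v j s.
have Ev j : bfs_carrier E (v j) by exact: carrier_step_lower_seq.
have Eu j : bfs_carrier E (u j) by exact: bfs_add Ef (bfs_scale _ (Ev j)).
have ffin s : (0 < s)%R -> f s \is a fin_num by exact: noninc_fin Ef s.
have v0 j s : 0 <= v j s by exact: step_lower_seq_ge0.
have vf j s : (0 < s)%R -> v j s <= f s by exact: (step_lower_seq_le f0 ndf Ef).
have uE j s : u j s = f s - v j s by rewrite /u mulN1e.
have vfin j s : v j s \is a fin_num by [].
have u0 j s : (0 < s)%R -> 0 <= u j s by move=> s0; rewrite uE sube_ge0 ?vf ?vfin ?orbT.
have nu : nrm (u j) @[j --> \oo] --> 0%R.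
  apply: (E_oc Ef).
  - by move=> j; split => //; apply: ae_pos => s s0; exact: u0.
  - move=> j; apply: ae_pos => s s0; rewrite uE gee0_abs ?f0//.
    by rewrite leeBlDr ?vfin// leeDl.
  - apply: ae_pos => s s0; apply: ereal_cvg0 => [j|e e0]; first exact: u0.
    (* [f] stays above [c] slightly to the right of [s], and once the mesh is small the right end of
       the block of [s] lies there. A negative [c] is trivial since [v j] is nonnegative. *)
    pose c := (fine (f s) - e)%R.
    have [c0|c0] := ltP c 0%R.
      apply: nearW => j; rewrite uE leeBlDr ?vfin//.
      apply: (@le_trans _ _ e%:E); last by rewrite leeDl.
      by rewrite -(fineK (ffin _ s0)) lee_fin -subr_le0 ltW.
    have [|d d0 cf] := @rearr_right_lsc x c s mx c0.
      by rewrite -/(f s) -(fineK (ffin _ s0)) lte_fin ltrBlDr ltrDl.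
    have dinf : \forall j \near \oo, (h j < d)%R.
      exists (Num.truncn d^-1) => // j /= dj.
      rewrite /h invf_plt ?posrE//; apply: lt_le_trans (truncnS_gt _) _.
      by rewrite ler_nat ltnS.
    have sinf : \forall j \near \oo, (s < j.+1%:R)%R.
      exists (Num.truncn s) => // j /= sj.
      by apply: lt_le_trans (truncnS_gt _) _; rewrite ler_nat ltnS.
    near=> j.
    have sj : (s < j.+1%:R)%R by near: j.
    have hd : (h j < d)%R by near: j.
    rewrite uE leeBlDr ?vfin// -(fineK (ffin _ s0)).
    apply: (@le_trans _ _ (e%:E + c%:E)).
      by rewrite -EFinD lee_fin /c addrC subrK.
    rewrite leeD2lE//; apply/ltW.
    have sh0 : (0 <= s / h j)%R by rewrite divr_ge0// ltW.
    rewrite /v /step /lower_seq ifT; last first.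
      by rewrite truncn_lt_nat// natrM ltr_pdivrMr// mulfK ?pnatr_eq0.
    rewrite fineK; last by rewrite ffin// mulr_gt0.
    apply: cf; rewrite -natr1 mulrDl mul1r ler_ltD//.
    by rewrite -ler_pdivlMr// truncn_le.
have lim : (nrm (u j) + (nrm g + nrm g))%R @[j --> \oo] --> (0 + (nrm g + nrm g))%R.
  by apply: cvgD => //; exact: cvg_cst.
rewrite -[leRHS]add0r; apply: (ler_cvg_to (cvg_cst _) lim).
apply: nearW => j.
apply: (@le_trans _ _ (nrm (fun s => u j s + v j s))).
  apply: bfs_norm_le; [exact: L0_rearr|exact: bfs_add|].
  by move=> s s0; rewrite uE subeK ?vfin.
apply: (le_trans (bfs_normD (Eu j) (Ev j))); rewrite lerD2l.
exact: norm_step_majorized.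
Unshelve. all: by end_near. Qed.

End hardy_littlewood_polya.

(** * Growth of the fundamental function *)

Section fundamental_growth.
Context {R : realType}.
Notation mu := (@lebesgue_measure R).
Variable E : banach_function_space R.
Notation nrm := (bfs_norm E).
Notation phi := (fundamental_function E).
Hypothesis E_symmetric : symmetric_space E.

Lemma rearr_average_bound x (a : R) : bfs_carrier E x -> (0 < a)%R ->
  (phi a)%:E * \int[mu]_(s in `]0%R, a[) rearr x s <= (a * nrm x)%:E.
Proof.
move=> Ex a0; rewrite -(bfs_norm_rearr E_symmetric Ex).
apply: average_bound => //.
- by move=> s _; exact: rearr_ge0.
- by move=> s t _; exact: le_rearr.
- exact: bfs_carrier_rearr.
Qed.

Lemma integral_rearr_lty x (a : R) : bfs_carrier E x -> (0 < a)%R ->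
  \int[mu]_(s in `]0%R, a[) rearr x s < +oo.
Proof.
move=> Ex a0; apply: (integral_itvo_lty E_symmetric) => //.
- by move=> s _; exact: rearr_ge0.
- by move=> s t _; exact: le_rearr.
- exact: bfs_carrier_rearr.
Qed.

Lemma measurable_rearr (x : R -> \bar R) (A : set R) : measurable A ->
  A `<=` halfline R -> measurable_fun A (rearr x).
Proof. by move=> mA Ah; exact: measurable_funS Ah (L0_rearr x). Qed.

Lemma integral_rearr_itvo x : L0 x ->
  \int[mu]_(s in halfline R) `|x s| = \int[mu]_(s in `]0%R, +oo[) rearr x s.
Proof.
move=> mx; rewrite integral_rearr// /halfline integral_itv_obnd_cbnd//.
by apply: measurable_rearr => // s /=; rewrite in_itv /= andbT halflineE => /ltW.
Qed.

(** With phi(a)/a >= e the average bound controls the integral of x^* over ]0, a[ uniformly in [a];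
    let [a] tend to infinity. *)
Lemma integral_le_of_fundamental (e : R) x : (0 < e)%R ->
  (forall a, (0 < a)%R -> (e * a <= phi a)%R) -> bfs_carrier E x ->
  e%:E * \int[mu]_(s in halfline R) `|x s| <= (nrm x)%:E.
Proof.
move=> e0 ephi Ex; rewrite integral_rearr_itvo; last exact: bfs_measurable Ex.
pose F n := `]0%R, n.+1%:R[%classic : set R.
have Fh n : F n `<=` halfline R by exact: halfline_sub_itvo.
have UF : \bigcup_n F n = `]0%R, +oo[%classic.
  apply/seteqP; split => [s [n _]|s]; rewrite /F /= !in_itv /= => /andP[s0 s1].
    by rewrite s0.
  by exists (Num.truncn s) => //=; rewrite in_itv /= s0 truncnS_gt.
have cv : \int[mu]_(s in F n) rearr x s @[n --> \oo] -->
    \int[mu]_(s in `]0%R, +oo[) rearr x s.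
  rewrite -UF; apply: ge0_nondecreasing_set_cvg_integral.
  - move=> m n mn; apply/subsetPset => s; rewrite /F /= !in_itv /= => /andP[-> s1].
    by apply: (lt_le_trans s1); rewrite ler_nat.
  - by move=> n; exact: measurable_itv.
  - by move=> n; apply: measurable_rearr => //; exact: measurable_itv.
  - by move=> n s _; exact: rearr_ge0.
apply: (cvge_le _ (cvgeZl (y := e%:E) _ cv)) => //; apply: nearW => n.
have n0 : (0 < n.+1%:R :> R)%R by [].
have := rearr_average_bound Ex n0; rewrite -/(F n) => H.
rewrite -(lee_pmul2l (x := n.+1%:R%:E))// muleA -!EFinM.
apply: le_trans H; apply: lee_wpmul2r.
  by apply: integral_ge0 => s _; exact: rearr_ge0.
by rewrite lee_fin mulrC ephi.
Qed.

Lemma embedded_of_fundamental (e : R) : (0 < e)%R ->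
  (forall a, (0 < a)%R -> (e * a <= phi a)%R) -> embedded_in_L1 E.
Proof.
move=> e0 ephi.
have bound x : bfs_carrier E x ->
    \int[mu]_(s in halfline R) `|x s| <= (e^-1 * nrm x)%:E.
  move=> Ex; rewrite EFinM lee_pdivlMl//.
  exact: integral_le_of_fundamental.
split; last by exists e^-1%R; rewrite ?invr_gt0.
move=> x Ex; apply/integrableP; split; first exact: bfs_measurable Ex.
exact: le_lt_trans (bound _ Ex) (ltry _).
Qed.

(** Failure of the embedding gives a single [a] with phi(a) < (e/2) a. For t >= a, cover ]0, t[ by n
    intervals of length [a]; rounding up costs n a <= 2 t, hence the e/2. *)
Lemma fundamental_sublinear : ~ embedded_in_L1 E ->
  forall e : R, (0 < e)%R ->
  exists2 T, (0 < T)%R & forall t, (T <= t)%R -> (phi t <= e * t)%R.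
Proof.
move=> nemb e e0; have e20 : (0 < e / 2)%R by rewrite divr_gt0.
have [a a0 pa] : exists2 a, (0 < a)%R & (phi a < e / 2 * a)%R.
  apply: contrapT => nex; apply: nemb; apply: (embedded_of_fundamental e20).
  by move=> a a0; rewrite leNgt; apply/negP => pa; apply: nex; exists a.
exists a => // t at_; have t0 : (0 < t)%R by exact: lt_le_trans at_.
pose n := (Num.truncn (t / a)).+1.
have tn : (t <= n%:R * a)%R by rewrite -ler_pdivrMr// ltW// truncnS_gt.
have nt : (n%:R * a <= 2 * t)%R.
  have := truncn_le (t / a); rewrite divr_ge0 ?(ltW a0) ?(ltW t0)//.
  rewrite ler_pdivlMr// => h; rewrite /n -natr1 mulrDl mul1r.
  by lra.
apply: (le_trans (le_fundamental E_symmetric tn)).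
apply: (le_trans (fundamental_natM E_symmetric _ (ltW a0))).
apply: (@le_trans _ _ (n%:R * (e / 2 * a))%R); first by rewrite ler_wpM2l// ltW.
by rewrite mulrCA (le_trans (ler_wpM2l (ltW e20) nt))// mulrA divfK.
Qed.

(** x^* vanishes from [a] on, and rearrangements of elements of [E] are integrable near 0. *)
Lemma integral_lty_of_support x (a : R) : bfs_carrier E x -> (0 < a)%R ->
  distr_fun x 0 <= a%:E -> \int[mu]_(s in halfline R) `|x s| < +oo.
Proof.
move=> Ex a0 xa; have mx := bfs_measurable Ex.
rewrite integral_rearr_itvo//.
have UE : `]0%R, +oo[%classic = `]0%R, a[%classic `|` `[a, +oo[%classic :> set R.
  by apply: itv_bndbnd_setU; rewrite bnd_simp.
rewrite UE ge0_integral_setU//=.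
- rewrite [X in _ + X]integral0_eq; first by rewrite adde0 integral_rearr_lty.
  move=> s /=; rewrite in_itv /= andbT => as_; apply/eqP.
  rewrite eq_le rearr_ge0 andbT; apply/lee_addgt0Pr => e e0; rewrite add0e.
  apply: le_rearr_distr => //; apply: (le_trans (le_distr mx (ltW e0))).
  by apply: (le_trans xa); rewrite lee_fin.
- rewrite -UE; apply: measurable_rearr => // s /=.
  by rewrite in_itv /= andbT halflineE => /ltW.
- by move=> s _; exact: rearr_ge0.
- apply/disj_setPLR => s /= ; rewrite !in_itv /= => /andP[_ s1]; apply/negP.
  by rewrite andbT -ltNge.
Qed.

(** Cut at height 1: the part above lives on a set of finite measure and is therefore integrable. *)
Lemma carrier_L1_plus_Linfty x : bfs_carrier E x ->
  distr_fun x 1 < +oo -> L1_plus_Linfty x.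
Proof.
move=> Ex x1; have mx := bfs_measurable Ex; split => //.
pose A := halfline R `&` [set s | 1%:E < `|x s|].
have mA : measurable A by exact: measurable_distr_set.
pose B := halfline R `\` A.
have mB : measurable B by exact: measurableD.
pose f s := x s * chi A s; pose g s := x s * chi B s.
have mf : L0 f by apply: emeasurable_funM => //; exact: L0_chi.
have mg : L0 g by apply: emeasurable_funM => //; exact: L0_chi.
have fA s : A s -> f s = x s by move=> As; rewrite /f /chi indicE mem_set// mule1.
have fNA s : ~ A s -> f s = 0 by move=> As; rewrite /f /chi indicE memNset// mule0.
have gB s : B s -> g s = x s by move=> As; rewrite /g /chi indicE mem_set// mule1.
have gNB s : ~ B s -> g s = 0 by move=> As; rewrite /g /chi indicE memNset// mule0.
have Ef : bfs_carrier E f.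
  apply: (bfs_carrier_le mf Ex) => s _.
  by have [As|As] := pselect (A s); [rewrite fA|rewrite fNA// abse0].
exists f, g; split.
- apply/integrableP; split => //.
  pose a := (fine (distr_fun x 1) + 1)%R.
  have xfin : distr_fun x 1 \is a fin_num by rewrite ge0_fin_numE.
  have a0 : (0 < a)%R by rewrite /a ltr_wpDl// fine_ge0.
  apply: (integral_lty_of_support Ef a0).
  apply: (@le_trans _ _ (distr_fun x 1)); last first.
    by rewrite -(fineK xfin) lee_fin /a lerDl.
  apply: le_measure; rewrite ?inE; [exact: measurable_distr_set|exact: mA|].
  move=> s [hs] /= f0; have [//|As] := pselect (A s).
  by move: f0; rewrite fNA// abse0 ltxx.
- split => //; exists 1%R; apply: aeW_halfline => s hs.
  have [Bs|Bs] := pselect (B s); last by rewrite gNB// abse0 lee_fin.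
  by rewrite gB// leNgt; apply/negP => xs; apply: Bs.2; split.
- apply: aeW_halfline => s hs; have [As|As] := pselect (A s).
    by rewrite fA// gNB ?adde0// => -[].
  by rewrite fNA// gB ?add0e.
Qed.

(** Otherwise the indicator of {|x| > l}, which is below |x|/l, would be equimeasurable with 1. *)
Lemma distr_lty x (l : R) : ~ bfs_carrier E (chi (halfline R)) ->
  bfs_carrier E x -> (0 < l)%R -> distr_fun x l < +oo.
Proof.
move=> nE Ex l0; rewrite ltey; apply/eqP => xoo; apply: nE.
have mx := bfs_measurable Ex.
pose A := halfline R `&` [set s | l%:E < `|x s|].
have mA : measurable A by exact: measurable_distr_set.
have Ah : A `<=` halfline R by move=> s [].
have EA : bfs_carrier E (chi A).
  apply: (bfs_carrier_le (L0_chi mA) (bfs_scale l^-1 Ex)) => s s0.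
  rewrite /chi indicE; have [|_] := boolP (s \in A); last by rewrite abse0 abse_ge0.
  rewrite inE => -[_ /= lx]; rewrite abseM !abse_EFin normr1 ger0_norm; last first.
    by rewrite invr_ge0 ltW.
  by rewrite lee_pdivlMl// mule1 ltW.
apply: (bfs_carrier_equi E_symmetric _ EA); first exact: L0_chi.
move=> k k0; rewrite !distr_chi//.
rewrite (_ : mu A = +oo)// (_ : mu (halfline R) = +oo)//.
by rewrite lebesgue_measure_itv /= ltry.
Qed.

(** The indicators of [n, oo[ decrease to 0, yet all are equimeasurable with 1 and so share its
    nonzero norm. *)
Lemma oc_not_carrier_one : order_continuous E -> ~ bfs_carrier E (chi (halfline R)).
Proof.
move=> oc E1.
pose F (n : nat) := `[n%:R, +oo[%classic : set R.
have Fh n : F n `<=` halfline R.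
  by move=> s; rewrite /F /= in_itv /= andbT halflineE; exact: le_trans.
have mF n : measurable (F n) by exact: measurable_itv.
have muF n : mu (F n) = +oo by rewrite lebesgue_measure_itv /= ltry.
have F0 : F 0%N = halfline R by [].
have dF n l : (0 <= l)%R -> distr_fun (chi (F n)) l = distr_fun (chi (halfline R)) l.
  by move=> l0; rewrite !distr_chi// -F0 !muF.
have EF n := bfs_carrier_equi E_symmetric (L0_chi (mF n)) E1 (dF n).
have nF n := bfs_norm_equi E_symmetric (L0_chi (mF n)) E1 (dF n).
have : nrm (chi (F n)) @[n --> \oo] --> 0%R.
  apply: (oc _ _ E1).
  - by move=> n; split => //; apply: aeW_halfline => s _; exact: chi_ge0.
  - move=> n; apply: aeW_halfline => s hs; rewrite gee0_abs ?chi_ge0// /chi lee_fin.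
    by rewrite !indicE [in leRHS]mem_set// ler_nat leq_b1.
  - apply: aeW_halfline => s hs; apply: ereal_cvg0 => [n|e e0]; first exact: chi_ge0.
    exists (Num.truncn s).+1 => // n /= sn.
    rewrite /chi indicE memNset ?lee_fin ?(ltW e0)// /F /= in_itv /= andbT.
    apply/negP; rewrite -ltNge; apply: lt_le_trans (truncnS_gt _) _.
    by rewrite ler_nat.
under eq_fun do rewrite nF.
move=> /(cvg_lim (@Rhausdorff R)); rewrite lim_cst// => n0.
have [s /andP[s0 _]] := ae_halfline_ex ltr01 (bfs_norm_eq0 E1 n0).
by rewrite /chi indicE mem_set ?halflineE ?(ltW s0)// => -[] /eqP; rewrite oner_eq0.
Qed.

Lemma nondecreasing_fundamental : nondecreasing_fun (fun t => (phi t)%:E).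
Proof. by move=> s t st; rewrite lee_fin le_fundamental. Qed.

(** If 1 is in [E], its norm bounds [phi]; if [phi] is bounded, the Fatou property applied to the
    indicators of ]0, n[ puts 1 in [E]. *)
Lemma fundamental_inftyP : fatou_property E ->
  fundamental_infty E = +oo <-> ~ bfs_carrier E (chi (halfline R)).
Proof.
move=> fatou.
have -> : fundamental_infty E = ereal_sup (range (fun t => (phi t)%:E)).
  by apply/cvg_lim => //; apply: nondecreasing_cvge; exact: nondecreasing_fundamental.
split => [supoo E1|nE].
  suff : ereal_sup (range (fun t => (phi t)%:E)) <= (nrm (chi (halfline R)))%:E.
    by rewrite supoo leye_eq.
  apply: ge_ereal_sup => _ [t _ <-]; rewrite lee_fin.
  apply: bfs_norm_le => //; first exact: L0_chi.
  move=> s s0; rewrite !gee0_abs ?chi_ge0// /chi lee_fin.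
  by rewrite !indicE [in leRHS]mem_set ?halflineE ?(ltW s0)// ler_nat leq_b1.
apply: contrapT => nsup; apply: nE.
pose S := ereal_sup (range (fun t => (phi t)%:E)).
have phiS t : (phi t)%:E <= S by apply: ereal_sup_ubound; exists t.
have Sfin : S \is a fin_num.
  rewrite fin_numE; apply/andP; split; last exact/eqP.
  by apply/eqP => S0; have := phiS 0%R; rewrite S0.
pose u (n : nat) := chi `]0%R, n%:R[ : R -> \bar R.
have Eu n : bfs_carrier E (u n) by exact: carrier_chi_itvo.
have [//| | |] := fatou u (chi (halfline R)) _ _ (L0_chi measurable_halfline).
- by move=> n; split => //; apply: aeW_halfline => s _; exact: chi_ge0.
- exists (fine S) => _ [n _ <-]; rewrite -lee_fin fineK//; exact: phiS.
- apply: ae_pos => s s0; split.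
    apply/nondecreasing_seqP => n; rewrite /u /chi lee_fin !indicE !mem_setE.
    rewrite !in_itv /= s0 /= ler_nat; case: ltP => // sn.
    by rewrite (lt_le_trans sn)// ler_nat.
  apply: cvg_near_cst; exists (Num.truncn s).+1 => // n /= sn.
  rewrite /u /chi !indicE [in RHS]mem_set ?halflineE ?(ltW s0)//.
  rewrite mem_setE in_itv /= s0 /= (lt_le_trans (truncnS_gt _))//.
  by rewrite ler_nat.
by [].
Qed.

(* Gliding hump: were the integrals unbounded on the unit ball, the sum of
   [2^-n |x_n|] with [\int |x_n f| > 4^n] would lie in [E] by the Fatou property. *)
Lemma associate_bounded f : fatou_property E -> associate_space E f ->
  exists C : R, forall x, bfs_carrier E x -> (nrm x <= 1)%R ->
    \int[mu]_(s in halfline R) `|x s * f s| <= C%:E.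
Proof.
move=> fatou [mf fE]; apply: contrapT => /forallNP nC.
have /choice[x xP] : forall n : nat, exists x, [/\ bfs_carrier E x, (nrm x <= 1)%R &
    (4 ^+ n)%:E < \int[mu]_(s in halfline R) `|x s * f s|].
  move=> n; have /existsNP[x /not_implyP[Ex /not_implyP[x1 /negP]]] := nC (4 ^+ n)%R.
  by rewrite -ltNge => xn; exists x.
pose y n s := (2 ^- n)%:E * `|x n s|.
have y0 n s : 0 <= y n s by rewrite mule_ge0// lee_fin invr_ge0 exprn_ge0.
have Ey n : bfs_carrier E (y n).
  by have [Ex _ _] := xP n; exact: bfs_scale (bfs_carrier_abs Ex).
have ny n : (nrm (y n) <= 2 ^- n)%R.
  have [Ex x1 _] := xP n; rewrite /y (bfs_normZ _ (bfs_carrier_abs Ex)).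
  rewrite ger0_norm ?invr_ge0 ?exprn_ge0// ler_piMr ?invr_ge0 ?exprn_ge0//.
  apply: le_trans x1; apply: bfs_norm_le => //.
    exact: bfs_measurable (bfs_carrier_abs Ex).
  by move=> s _ /=; rewrite abse_id.
pose w s := \sum_(n <oo) y n s.
have mw : L0 w.
  by apply: ge0_emeasurable_sum => // n _; exact: bfs_measurable (Ey n).
pose u n s := \sum_(0 <= k < n) y k s.
have yw n s : y n s <= w s.
  apply: (@le_trans _ _ (u n.+1 s)); last exact: nneseries_lim_ge.
  by rewrite /u big_nat_recr//= leeDr// sume_ge0.
have nu n : (nrm (u n) <= 2)%R.
  apply: (le_trans (bfs_carrier_sum (index_iota 0 n) Ey).2).
  (* The exact value of the geometric sum of 2^-k for k < n, which is what the induction needs. *)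
  apply: (@le_trans _ _ (2 - 2 * 2 ^- n)%R); last first.
    by rewrite lerBlDr lerDl mulr_ge0// invr_ge0 exprn_ge0.
  elim: n => [|n ih]; first by rewrite big_nil expr0 invr1 mulr1 subrr.
  rewrite big_nat_recr//=; apply: (le_trans (lerD ih (ny n))).
  by rewrite exprS invfM mulrA divff// mul1r; lra.
have Ew : bfs_carrier E w.
  have [//| | |] := fatou u w _ _ mw.
  - move=> n; split; first exact: (bfs_carrier_sum (index_iota 0 n) Ey).1.
    by apply: aeW_halfline => s _; exact: sume_ge0.
  - by exists 2%R => _ [n _ <-].
  - apply: aeW_halfline => s _; split.
      apply/nondecreasing_seqP => n; rewrite /u big_nat_recr//=.
      by rewrite leeDl.
    exact: is_cvg_nneseries.
  - by [].
have wlarge n : (2 ^+ n)%:E <= \int[mu]_(s in halfline R) `|w s * f s|.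
  have [Ex x1 xn] := xP n; have mx := bfs_measurable Ex.
  apply: (@le_trans _ _ ((2 ^- n)%:E * \int[mu]_(s in halfline R) `|x n s * f s|)).
    apply: (@le_trans _ _ ((2 ^- n)%:E * (4 ^+ n)%:E)).
      rewrite -EFinM lee_fin (_ : 4 = 2 * 2)%R; last by lra.
      by rewrite exprMn mulrA mulVf ?mul1r// expf_neq0.
    by rewrite lee_wpmul2l ?(ltW xn)// lee_fin invr_ge0 exprn_ge0.
  rewrite -ge0_integralZl//; last first.
    by apply: measurableT_comp => //; exact: emeasurable_funM.
  apply: ge0_le_integral => //.
  - apply: emeasurable_funM => //.
    by apply: measurableT_comp => //; exact: emeasurable_funM.
  - by apply: measurableT_comp => //; exact: emeasurable_funM.
  - move=> s _; rewrite !abseM muleA lee_wpmul2r//.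
    by apply: le_trans (yw n s) _; exact: lee_abs.
have : \int[mu]_(s in halfline R) `|w s * f s| < +oo by exact: fE.
rewrite ltNge => /negP; apply; rewrite leye_eq; apply/eqP/eqyP => r _.
pose n := Num.truncn `|r|%R.
apply: le_trans (wlarge n.+1); rewrite lee_fin (le_trans (ler_norm r))//.
apply: (le_trans (ltW (truncnS_gt _))).
by rewrite -natrX ler_nat ltnW// ltn_expl.
Qed.

End fundamental_growth.

(** * From the associate space *)

Section implications.
Context {R : realType}.
Notation mu := (@lebesgue_measure R).
Implicit Types x y f g : R -> \bar R.

Lemma nonincreasing_rearr x : nonincreasing_fun (rearr x).
Proof. by move=> s t; exact: le_rearr. Qed.

Lemma rearr_inftyE x : rearr_infty x = ereal_inf (range (rearr x)).
Proof.
by apply/cvg_lim => //; apply: nonincreasing_cvge; exact: nonincreasing_rearr.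
Qed.

Lemma rearr_infty_eq0 x : (forall c, (0 < c)%R -> distr_fun x c < +oo) ->
  rearr_infty x = 0.
Proof.
move=> xfin; rewrite rearr_inftyE; apply/eqP; rewrite eq_le; apply/andP; split.
  apply/lee_addgt0Pr => c c0; rewrite add0e.
  apply: (@le_trans _ _ (rearr x (fine (distr_fun x c)))).
    by apply: ereal_inf_lbound; exists (fine (distr_fun x c)).
  apply: le_rearr_distr => //; rewrite fineK//.
  by rewrite ge0_fin_numE// xfin.
by apply: le_ereal_inf_tmp => _ [t _ <-]; exact: rearr_ge0.
Qed.

Lemma rearr_infty_one : rearr_infty (cst 1 : R -> \bar R) != 0.
Proof.
apply/negP => /eqP h.
suff : 2^-1%:E <= rearr_infty (cst 1 : R -> \bar R).
  by rewrite h lee_fin leNgt invr_gt0 ltr0n.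
rewrite rearr_inftyE; apply: le_ereal_inf_tmp => _ [t _ <-].
rewrite ltW// lt_rearr; [|exact: measurable_cst|by rewrite invr_ge0].
rewrite (_ : distr_fun _ _ = +oo) ?ltry// /distr_fun.
rewrite (_ : _ `&` _ = `[0%R, +oo[%classic) ?lebesgue_measure_itv /= ?ltry//.
apply/seteqP; split => [s []//|s hs]; split => //=.
by rewrite normr1 lte_fin invf_lt1// ltr1n.
Qed.

Lemma integral_mulchi (D B : set R) f : measurable D -> measurable B ->
  \int[mu]_(s in D) (f s * chi B s) = \int[mu]_(s in D `&` B) f s.
Proof.
move=> mD mB; rewrite integral_mkcondr; apply: eq_integral => s _.
rewrite /chi patchE indicE; case: ifP => _; first by rewrite mule1.
by rewrite mule0.
Qed.

Variable E : banach_function_space R.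
Notation nrm := (bfs_norm E).
Notation phi := (fundamental_function E).
Hypothesis E_symmetric : symmetric_space E.
Hypothesis E_fatou : fatou_property E.

Lemma associate_distr_lty f c : ~ embedded_in_L1 E -> associate_space E f ->
  (0 < c)%R -> distr_fun f c < +oo.
Proof.
move=> nemb E'f c0; have mf := E'f.1.
rewrite ltey; apply/eqP => foo.
have [C bC] := associate_bounded E_fatou E'f.
(* Whenever phi(b) <= e b, testing [f] against the normalized indicator of a set of measure [b]
   gives at least c b / phi(b) >= |C| + 1, beyond the bound [C]. *)
pose e := (c / (`|C| + 1))%R.
have C0 : (0 < `|C| + 1 :> R)%R by rewrite ltr_wpDl.
have e0 : (0 < e)%R by rewrite divr_gt0.
have [T T0 bT] := fundamental_sublinear E_symmetric nemb e0.
pose A := halfline R `&` [set s | c%:E < `|f s|].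
have mA : measurable A by exact: measurable_distr_set.
(* [A] itself has infinite measure; its bounded pieces have indicators in [E], and their measures
   eventually exceed the threshold [T]. *)
pose B n := A `&` `[0%R, n%:R]%classic.
have mB n : measurable (B n) by apply: measurableI => //; exact: measurable_itv.
have Bh n : B n `<=` halfline R by move=> s [[]].
have Boo n : mu (B n) < +oo.
  apply: (@le_lt_trans _ _ (mu `[0%R, n%:R])).
    by apply: le_measure; rewrite ?inE; [exact: mB|exact: measurable_itv|move=> s []].
  by rewrite lebesgue_measure_itv /=; case: ifP => //; rewrite oppr0 adde0 ltry.
have UB : \bigcup_n B n = A.
  apply/seteqP; split => [s [n _] []//|s As].
  exists (Num.truncn s).+1 => //; split => //; rewrite /= in_itv /=.
  have [hs _] := As; move: hs; rewrite halflineE => ->.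
  by rewrite ltW// truncnS_gt.
have cv : mu (B n) @[n --> \oo] --> mu A.
  rewrite -UB; apply: nondecreasing_cvg_mu => //; first by rewrite UB.
  move=> m n mn; apply/subsetPset => s [As]; rewrite /= !in_itv /= => /andP[s0 sm].
  by split => //=; rewrite in_itv /= s0 (le_trans sm)// ler_nat.
have [n nT] : exists n, T%:E < mu (B n).
  apply: contrapT => /forallNP nT.
  have : mu A <= T%:E.
    by apply: (cvge_le _ cv); apply: nearW => n; rewrite leNgt; exact/negP/nT.
  by rewrite [mu A]foo.
have Bfin : mu (B n) \is a fin_num by rewrite ge0_fin_numE.
pose b := fine (mu (B n)); have bE : mu (B n) = b%:E by rewrite fineK.
have Tb : (T < b)%R by rewrite -lte_fin -bE.
have b0 : (0 < b)%R by exact: lt_trans Tb.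
have pb0 : (0 < phi b)%R by exact: fundamental_gt0.
have EB : bfs_carrier E (chi (B n)) by exact: carrier_chi.
have : (nrm (fun s => (phi b)^-1%:E * chi (B n) s)%E <= 1)%R.
  rewrite bfs_normZ// norm_chi// -/b ger0_norm ?invr_ge0 ?(ltW pb0)//.
  by rewrite mulVf// gt_eqF.
move=> /(bC _ (bfs_scale _ EB)); apply/negP; rewrite -ltNge.
apply: (@lt_le_trans _ _ (\int[mu]_(s in halfline R)
    (((phi b)^-1 * c)%:E * chi (B n) s))).
  rewrite integral_mulchi// integral_cst; last by apply: measurableI => //; exact: mB.
  rewrite setIidr// [X in _ * X]bE -EFinM lte_fin.
  apply: (@lt_le_trans _ _ (`|C| + 1)%R).
    by rewrite (le_lt_trans (ler_norm _))// ltrDl.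
  rewrite -mulrA ler_pdivlMl// (@le_trans _ _ (e * b * (`|C| + 1))%R)//.
    by rewrite ler_wpM2r ?(ltW C0)// bT// ltW.
  by rewrite mulrAC /e divfK ?gt_eqF.
have chiM : measurable_fun (halfline R) (chi (B n)) by exact: L0_chi.
apply: ge0_le_integral => //.
- by move=> s _; rewrite mule_ge0 ?chi_ge0// lee_fin mulr_ge0// ?ltW ?invr_gt0.
- exact: measurable_funeM.
- apply: measurableT_comp => //; apply: emeasurable_funM => //.
  exact: measurable_funeM.
- move=> s hs; rewrite abseM abseM gee0_abs ?lee_fin ?invr_ge0 ?(ltW pb0)//.
  rewrite [X in _ * X * _]gee0_abs ?chi_ge0// /chi indicE.
  have [|_] := boolP (s \in B n); last by rewrite !mule0 mul0e.
  rewrite inE => -[[_ /= cf] _]; rewrite !mule1 EFinM.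
  by rewrite lee_wpmul2l ?(ltW cf)// lee_fin invr_ge0 ltW.
Qed.

(** An inclusion of [E] in L^1 would place the constant 1 in the associate space. *)
Lemma not_embedded_of_associate :
  (forall f, associate_space E f -> rearr_infty f = 0) -> ~ embedded_in_L1 E.
Proof.
move=> E'0 [EL1 _]; have := rearr_infty_one; rewrite E'0 ?eqxx//; split.
  exact: measurable_cst.
move=> x Ex; have /integrableP[_] := EL1 _ Ex; apply: le_lt_trans.
by under eq_integral do rewrite mule1.
Qed.

End implications.

(** * K-order continuity from order continuity *)

Section K_order_continuity.
Context {R : realType}.
Notation mu := (@lebesgue_measure R).
Implicit Types x y f g : R -> \bar R.

Lemma L0_integrand (t : R) f : L0 f -> measurable_fun `]0%R, t[ f.
Proof. by move=> mf; apply: measurable_funS mf => //; exact: halfline_sub_itvo. Qed.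

Lemma integral_itvoD (t : R) f g : L0 f -> L0 g ->
  (forall s, (0 < s)%R -> 0 <= f s) -> (forall s, (0 < s)%R -> 0 <= g s) ->
  \int[mu]_(s in `]0%R, t[) (f s + g s) =
  \int[mu]_(s in `]0%R, t[) f s + \int[mu]_(s in `]0%R, t[) g s.
Proof.
move=> mf mg f0 g0; rewrite ge0_integralD//; try exact: L0_integrand.
- by move=> s; rewrite /= in_itv /= => /andP[/f0].
- by move=> s; rewrite /= in_itv /= => /andP[/g0].
Qed.

Lemma le_integral_itvo (t : R) f g : L0 f -> L0 g ->
  (forall s, (0 < s)%R -> 0 <= f s) ->
  (forall s, (0 < s < t)%R -> f s <= g s) ->
  \int[mu]_(s in `]0%R, t[) f s <= \int[mu]_(s in `]0%R, t[) g s.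
Proof.
move=> mf mg f0 fg; apply: ge0_le_integral => //; try exact: L0_integrand.
  by move=> s; rewrite /= in_itv /= => /andP[/f0].
Qed.

Lemma integral_itvo_chi (t b : R) f :
  \int[mu]_(s in `]0%R, t[) (f s * chi `]0%R, b[ s) =
  \int[mu]_(s in `]0%R, (Num.min t b)[) f s.
Proof.
rewrite integral_mulchi//; congr (integral _ _ _).
apply/seteqP; split => s /=; rewrite !in_itv /= lt_min.
  by move=> [/andP[-> ->] /andP[_ ->]].
by move=> /and3P[-> -> ->].
Qed.

Variable E : banach_function_space R.
Notation nrm := (bfs_norm E).
Notation phi := (fundamental_function E).
Hypothesis E_symmetric : symmetric_space E.

Section from_order_continuity.
Hypothesis E_oc : order_continuous E.
Hypothesis E_nemb : ~ embedded_in_L1 E.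

Lemma oc_head x (e : R) : bfs_carrier E x -> (0 < e)%R ->
  exists2 d, (0 < d)%R &
    bfs_carrier E (fun s => rearr x s * chi `]0%R, d[ s) /\
    (nrm (fun s => rearr x s * chi `]0%R, d[ s)%E <= e)%R.
Proof.
move=> Ex e0; have Ey := bfs_carrier_rearr E_symmetric Ex.
pose d (n : nat) : R := (n.+1%:R^-1)%R.
pose v n s := rearr x s * chi `]0%R, (d n)[ s.
have v0 n s : 0 <= v n s by rewrite mule_ge0 ?rearr_ge0 ?chi_ge0.
have vle n s : v n s <= rearr x s.
  rewrite /v /chi indicE; case: (_ \in _); first by rewrite mule1.
  by rewrite mule0 rearr_ge0.
have Ev n : bfs_carrier E (v n).
  apply: (bfs_carrier_le _ Ey) => [|s s0].
    by apply: emeasurable_funM; [exact: L0_rearr|exact: L0_chi].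
  by rewrite !gee0_abs ?rearr_ge0.
have : nrm (v n) @[n --> \oo] --> 0%R.
  apply: (E_oc Ey).
  - by move=> n; split => //; exact: aeW_halfline.
  - by move=> n; apply: aeW_halfline => s _; rewrite gee0_abs ?rearr_ge0.
  - apply: ae_pos => s s0; apply: ereal_cvg0 => // k k0.
    exists (Num.truncn s^-1) => // n /= sn.
    rewrite /v /chi indicE memNset ?mule0 ?lee_fin ?(ltW k0)//= in_itv /= s0 /=.
    apply/negP; rewrite -leNgt /d invf_ple ?posrE// ltW//.
    by apply: lt_le_trans (truncnS_gt _) _; rewrite ler_nat ltnS.
move=> /cvgrPdist_le /(_ _ e0)[n _ /(_ n (leqnn _))].
rewrite sub0r normrN ger0_norm ?bfs_norm_ge0// => vn.
exists (d n); first by rewrite invr_gt0.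
by split; [exact: Ev|exact: vn].
Qed.

(** x^*(M) tends to 0 because 1 is not in [E]. The tail is cut by height instead of by support so
    that it stays nonincreasing, as [norm_majorized] requires. *)
Lemma oc_tail x (e : R) : bfs_carrier E x -> (0 < e)%R ->
  exists2 M, (0 < M)%R &
    bfs_carrier E (fun s => mine (rearr x s) (rearr x M)) /\
    (nrm (fun s => mine (rearr x s) (rearr x M)) <= e)%R.
Proof.
move=> Ex e0; have Ey := bfs_carrier_rearr E_symmetric Ex.
have mx := bfs_measurable Ex.
pose v (n : nat) s := mine (rearr x s) (rearr x n.+1%:R).
have v0 n s : 0 <= v n s by rewrite le_min !rearr_ge0.
have vle n s : v n s <= rearr x s by rewrite ge_min lexx.
have Ev n : bfs_carrier E (v n).
  apply: (bfs_carrier_le _ Ey) => [|s s0].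
    by apply: measurable_mine; [exact: L0_rearr|exact: measurable_cst].
  by rewrite !gee0_abs ?rearr_ge0.
have : nrm (v n) @[n --> \oo] --> 0%R.
  apply: (E_oc Ey).
  - by move=> n; split => //; exact: aeW_halfline.
  - by move=> n; apply: aeW_halfline => s _; rewrite gee0_abs ?rearr_ge0.
  - apply: ae_pos => s s0; apply: ereal_cvg0 => // k k0.
    have xk := distr_lty E_symmetric (oc_not_carrier_one E_symmetric E_oc) Ex k0.
    exists (Num.truncn (fine (distr_fun x k))) => // n /= kn.
    rewrite ge_min; apply/orP; right; apply: le_rearr_distr => //.
    rewrite -[leLHS]fineK ?ge0_fin_numE// lee_fin ltW//.
    by apply: lt_le_trans (truncnS_gt _) _; rewrite ler_nat ltnS.
move=> /cvgrPdist_le /(_ _ e0)[n _ /(_ n (leqnn _))].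
rewrite sub0r normrN ger0_norm ?bfs_norm_ge0// => vn.
exists n.+1%:R => //; split; [exact: (Ev n)|exact: vn].
Qed.

(* With [y = x^*] and [eta = z^*(d)], the function
   [y 1_(0,d) + eta 1_(0,K/eta) + min(y, y(M))] majorizes [z^*]: its first summand
   handles [z^*] on [(0,d)], the two others handle [min(z^*, eta)], whose
   integral over [(0,t)] is at most both [eta t] and [\int_(0,t) y]. *)
Lemma majorant_integral x z (d M K : R) : bfs_carrier E x -> bfs_carrier E z ->
  (0 < d)%R -> (0 < M)%R -> \int[mu]_(s in `]0%R, M[) rearr x s <= K%:E ->
  (forall t, (0 < t)%R ->
    \int[mu]_(s in `]0%R, t[) rearr z s <= \int[mu]_(s in `]0%R, t[) rearr x s) ->
  forall t, (0 < t)%R ->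
  \int[mu]_(s in `]0%R, t[) rearr z s <=
  \int[mu]_(s in `]0%R, t[) (rearr x s * chi `]0%R, d[ s +
    ((fine (rearr z d))%:E * chi `]0%R, (K / fine (rearr z d))%R[ s +
     mine (rearr x s) (rearr x M))).
Proof.
move=> Ex Ez d0 M0 xK zx t t0.
pose y := rearr x; pose f := rearr z; pose eta := fine (f d).
have y0 s : (0 < s)%R -> 0 <= y s by move=> _; exact: rearr_ge0.
have f0 s : (0 < s)%R -> 0 <= f s by move=> _; exact: rearr_ge0.
have my : L0 y by exact: L0_rearr.
have mf : L0 f by exact: L0_rearr.
have fd : f d \is a fin_num.
  apply: (noninc_fin f0 _ (bfs_carrier_rearr E_symmetric Ez)) => //.
  by move=> s s' _; exact: le_rearr.
have eta0 : (0 <= eta)%R by rewrite fine_ge0// f0.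
have mchi b : L0 (chi `]0%R, b[ : R -> \bar R) by exact: L0_chi.
have mM : L0 (fun s => mine (y s) (y M)).
  by apply: measurable_mine => //; exact: measurable_cst.
have mE : L0 (fun s => mine (f s) eta%:E).
  by apply: measurable_mine => //; exact: measurable_cst.
have meta b : L0 (fun s => eta%:E * chi `]0%R, b[ s) by apply: measurable_funeM;
  exact: mchi.
have myd b : L0 (fun s => y s * chi `]0%R, b[ s)
  by apply: emeasurable_funM => //; exact: mchi.
have mfd b : L0 (fun s => f s * chi `]0%R, b[ s)
  by apply: emeasurable_funM => //; exact: mchi.
have M_ge0 s : (0 < s)%R -> 0 <= mine (y s) (y M) by move=> _;
  rewrite le_min !rearr_ge0.
have E_ge0 s : (0 < s)%R -> 0 <= mine (f s) eta%:E.
  by move=> _; rewrite le_min rearr_ge0 lee_fin.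
have eta_ge0 b s : (0 < s)%R -> 0 <= eta%:E * chi `]0%R, b[ s.
  by move=> _; rewrite mule_ge0 ?chi_ge0// lee_fin.
have yd_ge0 b s : (0 < s)%R -> 0 <= y s * chi `]0%R, b[ s.
  by move=> _; rewrite mule_ge0 ?chi_ge0 ?rearr_ge0.
have fd_ge0 b s : (0 < s)%R -> 0 <= f s * chi `]0%R, b[ s.
  by move=> _; rewrite mule_ge0 ?chi_ge0 ?rearr_ge0.
have mS : L0 (fun s => eta%:E * chi `]0%R, (K / eta)%R[ s + mine (y s) (y M)).
  by apply: emeasurable_funD; [exact: meta|exact: mM].
have S_ge0 s : (0 < s)%R -> 0 <= eta%:E * chi `]0%R, (K / eta)%R[ s + mine (y s) (y M).
  by move=> s0; rewrite adde_ge0 ?eta_ge0 ?M_ge0.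
have head : \int[mu]_(s in `]0%R, t[) (f s * chi `]0%R, d[ s) <=
    \int[mu]_(s in `]0%R, t[) (y s * chi `]0%R, d[ s).
  by rewrite !integral_itvo_chi; apply: zx; rewrite lt_min t0.
have tail : \int[mu]_(s in `]0%R, t[) mine (f s) eta%:E <=
    \int[mu]_(s in `]0%R, t[) (eta%:E * chi `]0%R, (K / eta)%R[ s + mine (y s) (y M)).
  (* In this case the comparison is pointwise on ]0, t[. For [eta = 0] the quotient is 0 by
     convention and the truncated function vanishes. *)
  have [tK|tK] := boolP ((eta == 0%R) || (t <= K / eta)%R).
    apply: le_integral_itvo => // s /andP[s0 st].
    have [eta_0|eta_n0] := eqVneq eta 0%R.
      apply: (@le_trans _ _ 0); last exact: S_ge0.
      by rewrite eta_0 ge_min lexx orbT.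
    rewrite (negbTE eta_n0) /= in tK.
    apply: (@le_trans _ _ (eta%:E * chi `]0%R, (K / eta)%R[ s)); last first.
      by rewrite leeDl// M_ge0.
    by rewrite /chi indicE mem_set ?mule1 ?ge_min ?lexx ?orbT//= in_itv /= s0
      (lt_le_trans st).
  (* Past K/eta the block has delivered its full mass [K], enough to pay for the integral of [y]
     over ]0, M[; beyond [M] the truncation of [y] is [y] itself. *)
  move: tK; rewrite negb_or -ltNge => /andP[eta_n0 Kt].
  have eta_gt0 : (0 < eta)%R by rewrite lt_neqAle eq_sym eta_n0.
  rewrite integral_itvoD//; [|exact: eta_ge0].
  apply: (@le_trans _ _ (\int[mu]_(s in `]0%R, t[) y s)).
    apply: (le_trans _ (zx _ t0)); apply: le_integral_itvo => // s _.
    by rewrite ge_min lexx.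
  apply: (@le_trans _ _ (\int[mu]_(s in `]0%R, t[)
      (y s * chi `]0%R, M[ s + mine (y s) (y M)))).
    apply: le_integral_itvo => //; first by apply: emeasurable_funD;
      [exact: myd|exact: mM].
    move=> s /andP[s0 st]; have [sM|Ms] := ltP s M.
      by rewrite /chi indicE mem_set ?mule1 ?leeDl ?M_ge0//= in_itv /= s0.
    rewrite min_l ?leeDr ?yd_ge0//; exact: le_rearr.
  rewrite integral_itvoD//; last exact: yd_ge0.
  apply: leeD => //; rewrite integral_itvo_chi.
  apply: (@le_trans _ _ K%:E).
    apply: le_trans xK; apply: ge0_subset_integral => //.
    - exact: L0_integrand.
    - by move=> s _; exact: rearr_ge0.
    - by move=> s /=; rewrite !in_itv /= lt_min => /and3P[-> _ ->].
  have K0 : (0 <= K)%R.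
    rewrite -lee_fin; apply: le_trans xK; apply: integral_ge0 => s _; exact: rearr_ge0.
  rewrite (integral_itvo_chi t (K / eta)%R (cst eta%:E)) min_r; last exact: ltW.
  rewrite integral_cst_oo ?divr_ge0// subr0 -EFinM divfK//.
(* From [d] on, [f] is at most [f d = eta], so there it coincides with its truncation. *)
apply: (@le_trans _ _ (\int[mu]_(s in `]0%R, t[)
    (f s * chi `]0%R, d[ s + mine (f s) eta%:E))).
  apply: le_integral_itvo => //; first by apply: emeasurable_funD;
    [exact: mfd|exact: mE].
  move=> s /andP[s0 st]; have [sd|ds] := ltP s d.
    by rewrite /chi indicE mem_set ?mule1 ?leeDl ?E_ge0//= in_itv /= s0.
  rewrite min_l ?leeDr ?fd_ge0// /eta fineK//; exact: le_rearr.
rewrite (integral_itvoD t (mfd d) mE (fd_ge0 d) E_ge0).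
by rewrite (integral_itvoD t (myd d) mS (yd_ge0 d) S_ge0); exact: leeD.
Qed.

Lemma oc_K_order_continuous : K_order_continuous E.
Proof.
move=> x u Ex Eu ux ucvg.
apply/cvgrPdist_le => e e0.
(* Three summands of norm at most e/6, doubled by [norm_majorized]. *)
pose e6 := (e / 6)%R; have e60 : (0 < e6)%R by rewrite divr_gt0.
have [d d0 [Ed nd]] := oc_head Ex e60.
have [M M0 [EM nM]] := oc_tail Ex e60.
pose I := \int[mu]_(s in `]0%R, M[) rearr x s.
have I0 : 0 <= I by apply: integral_ge0 => s _; exact: rearr_ge0.
have Ifin : I \is a fin_num by rewrite ge0_fin_numE//; exact: integral_rearr_lty Ex M0.
pose K := (fine I + 1)%R.
have K0 : (0 < K)%R by rewrite ltr_wpDl// fine_ge0.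
have IK : I <= K%:E by rewrite -(fineK Ifin) lee_fin lerDl.
(* With this slope the block of height [eta] has norm eta phi(K/eta) <= eta (e6/K) (K/eta) = e6,
   independently of [eta]. *)
have eK0 : (0 < e6 / K)%R by rewrite divr_gt0.
have [T T0 bT] := fundamental_sublinear E_symmetric E_nemb eK0.
(* A single point of convergence [t < d] suffices, since the rearrangements at [d] are below their
   values at [t]. *)
have [t /andP[t0 td] ut] := ae_halfline_ex d0 ucvg.
(* For positive [eta], [eta <= K / T] means [T <= K / eta], the range where [bT] applies. *)
have KT0 : (0 < K / T)%R by rewrite divr_gt0.
have near_eta : \forall n \near \oo, rearr (u n) t <= (K / T)%:E.
  have /fine_cvgP[ufin /cvgrPdist_le /(_ _ KT0) uKT] := ut.
  near=> n; have fn : rearr (u n) t \is a fin_num by near: n.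
  have : (`|0 - fine (rearr (u n) t)| <= K / T)%R by near: n.
  rewrite sub0r normrN ger0_norm ?fine_ge0 ?rearr_ge0// => h.
  by rewrite -(fineK fn) lee_fin.
near=> n; rewrite sub0r normrN ger0_norm ?bfs_norm_ge0//.
pose eta := fine (rearr (u n) d).
have etaKT : (eta <= K / T)%R.
  have h : rearr (u n) d <= (K / T)%:E.
    by apply: le_trans (le_rearr _ (ltW td)) _; near: n.
  rewrite -lee_fin fineK// ge0_fin_numE ?rearr_ge0//.
  exact: le_lt_trans h (ltry _).
have eta0 : (0 <= eta)%R by rewrite fine_ge0// rearr_ge0.
pose g2 s := eta%:E * chi `]0%R, (K / eta)%R[ s.
have Echi := carrier_chi_itvo E_symmetric (K / eta)%R.
have E2 : bfs_carrier E g2 by exact: bfs_scale.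
have n2 : (nrm g2 <= e6)%R.
  rewrite bfs_normZ// ger0_norm//.
  have [->|eta_n0] := eqVneq eta 0%R; first by rewrite mul0r ltW.
  have eta_gt0 : (0 < eta)%R by rewrite lt_neqAle eq_sym eta_n0.
  have TK : (T <= K / eta)%R.
    by rewrite ler_pdivlMr// mulrC -ler_pdivlMr.
  apply: (@le_trans _ _ (eta * (e6 / K * (K / eta)))%R).
    by rewrite ler_wpM2l// bT.
  by rewrite [(e6 / K * _)%R]mulrA divfK ?gt_eqF// mulrC divfK.
pose g s := rearr x s * chi `]0%R, d[ s + (g2 s + mine (rearr x s) (rearr x M)).
have E3 := bfs_add E2 EM.
have Eg : bfs_carrier E g by exact: bfs_add Ed E3.
have ng : (nrm g <= e6 + (e6 + e6))%R.
  apply: (le_trans (bfs_normD Ed E3)); apply: lerD => //.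
  by apply: (le_trans (bfs_normD E2 EM)); exact: lerD.
have noninc_chi (b s s' : R) : (0 < s)%R -> (s <= s')%R -> chi `]0%R, b[ s' <=
  chi `]0%R, b[ s.
  move=> s0 ss'; rewrite /chi lee_fin !indicE !mem_setE !in_itv /= s0
    (lt_le_trans s0 ss') /=.
  by rewrite ler_nat; case: ltP => // s'b; rewrite (le_lt_trans ss' s'b).
have : (nrm (u n) <= nrm g + nrm g)%R.
  apply: (norm_majorized E_symmetric E_oc (Eu n)) => //.
  - move=> s s0; rewrite /g /g2 !adde_ge0 ?mule_ge0 ?chi_ge0 ?rearr_ge0 ?lee_fin//.
    by rewrite le_min !rearr_ge0.
  - move=> s s' s0 ss'; apply: leeD; last apply: leeD.
    + by apply: lee_pmul; rewrite ?rearr_ge0 ?chi_ge0 ?le_rearr ?noninc_chi.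
    + by apply: lee_wpmul2l; [rewrite lee_fin|exact: noninc_chi].
    + by rewrite le_min !ge_min lexx orbT le_rearr.
  - move=> s s0; apply: (majorant_integral Ex (Eu n) d0 M0 IK _ s0) => r r0.
    have [_ _ /(_ _ r0)] := ux n; rewrite /max_rearr.
    by rewrite lee_pmul2l// lte_fin invr_gt0.
move=> /le_trans; apply; rewrite /e6 in ng.
by lra.
Unshelve. all: by end_near. Qed.

End from_order_continuity.

End K_order_continuity.

(** * Order continuity from K-order continuity *)

Section converse.
Context {R : realType}.
Notation mu := (@lebesgue_measure R).
Implicit Types x y f g : R -> \bar R.

Lemma le_max_rearr x y : (forall s, (0 < s)%R -> rearr x s <= rearr y s) ->
  forall t, (0 < t)%R -> max_rearr x t <= max_rearr y t.
Proof.
move=> xy t t0; apply: lee_wpmul2l; first by rewrite lee_fin invr_ge0 ltW.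
apply: le_integral_itvo; [exact: L0_rearr|exact: L0_rearr| |].
  by move=> s _; exact: rearr_ge0.
by move=> s /andP[s0 _]; exact: xy.
Qed.

Lemma le_rearr_fun x y : L0 x -> L0 y ->
  ae_on_halfline (fun s => `|x s| <= `|y s|) -> forall s, rearr x s <= rearr y s.
Proof.
move=> mx my xy s; apply: le_ereal_inf => _ [l [l0 ly] <-]; exists l => //; split => //.
exact: le_trans (le_ae_distr_fun l mx my xy) ly.
Qed.

(** Continuity from above for [G k], the union of the exceedance sets from [k] on: these shrink to
    the empty set off [N], and domination by [x] gives the first one finite measure. *)
Lemma distr_cvg0 x (u : nat -> R -> \bar R) (e : R) : L0 x -> (forall n, L0 (u n)) ->
  (0 < e)%R -> distr_fun x e < +oo ->
  ae_on_halfline (fun s => (forall n, `|u n s| <= `|x s|) /\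
                           u n s @[n --> \oo] --> 0) ->
  distr_fun (u n) e @[n --> \oo] --> 0.
Proof.
move=> mx mun e0 xe [N [mN N0 uN]].
pose A n := halfline R `&` [set s | e%:E < `|u n s|].
have mA n : measurable (A n) by exact: measurable_distr_set.
pose G k := \bigcup_(n in [set n | (k <= n)%N]) (A n `\` N).
have mG k : measurable (G k).
  by apply: bigcup_measurable => n _; apply: measurableD => //; exact: mA.
have good s : halfline R s -> ~ N s -> (forall n, `|u n s| <= `|x s|) /\
    u n s @[n --> \oo] --> 0.
  by move=> hs Ns; apply: contrapT => h; apply: Ns; apply: uN => /= h'; apply/h/h'.
have Gx : mu (G 0%N) < +oo.
  apply: le_lt_trans xe; apply: le_measure; rewrite ?inE;
    [exact: mG|exact: measurable_distr_set|].
  move=> s [n _ [[hs /= es] Ns]]; split => //=; apply: (lt_le_trans es).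
  by have [+ _] := good s hs Ns; apply.
have G0 : \bigcap_k G k = set0.
  apply/seteqP; split => // s Gs.
  have [n0 _ [[hs _] Ns]] := Gs 0%N I.
  have [_ /fine_cvgP[ufin /cvgrPdist_lt /(_ _ e0) ue]] := good s hs Ns.
  have [k _ kP] := filterI ufin ue.
  have [n /= kn [[_ /= es] _]] := Gs k I.
  have [fn] := kP n kn; rewrite /= sub0r normrN => une.
  by move: es; rewrite -(fineK fn) abse_EFin lte_fin ltNge (ltW une).
have cG : mu (G k) @[k --> \oo] --> 0.
  rewrite -(measure0 mu) -G0; apply: nonincreasing_cvg_mu => //.
    by rewrite G0.
  move=> k l kl; apply/subsetPset => s [n /= ln An]; exists n => //=.
  exact: leq_trans ln.
have AG k : mu (A k) <= mu (G k).
  have GN : mu (G k `|` N) = mu (G k) by apply: measureU0;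
    [exact: mG|exact: mN|exact: N0].
  rewrite -GN; apply: le_measure; rewrite ?inE.
  - exact: mA.
  - by apply: measurableU => //; exact: mG.
  - move=> s As; have [Ns|Ns] := pselect (N s); first by right.
    by left; exists k => //; exact: leqnn.
apply: ereal_cvg0 => [n|k k0]; first exact: measure_ge0.
have [Gfin /cvgrPdist_le /(_ _ k0) Gk] := (fine_cvgP _ _).1 cG.
near=> n; apply: (le_trans (AG n)).
have fn : mu (G n) \is a fin_num by near: n.
have : (`|0 - fine (mu (G n))| <= k)%R by near: n.
by rewrite sub0r normrN ger0_norm ?fine_ge0// -lee_fin fineK.
Unshelve. all: by end_near. Qed.

Variable E : banach_function_space R.
Notation nrm := (bfs_norm E).
Notation phi := (fundamental_function E).
Hypothesis E_symmetric : symmetric_space E.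
Hypothesis E_Koc : K_order_continuous E.
Hypothesis E_not_one : ~ bfs_carrier E (chi (halfline R)).

(** The membership in L^1 + L^oo demanded by [hlp] comes from finiteness of the distribution
    functions at level 1. *)
Lemma carrier_hlp x y : bfs_carrier E x -> bfs_carrier E y ->
  (forall s, (0 < s)%R -> rearr x s <= rearr y s) -> hlp x y.
Proof.
move=> Ex Ey xy; split; last exact: le_max_rearr.
- by apply: (carrier_L1_plus_Linfty E_symmetric Ex); exact: distr_lty Ex ltr01.
- by apply: (carrier_L1_plus_Linfty E_symmetric Ey); exact: distr_lty Ey ltr01.
Qed.

Lemma K_oc_order_continuous : order_continuous E.
Proof.
move=> x u Ex Eu ux u0; have mx := bfs_measurable Ex.
have mu_ n := bfs_measurable (Eu n).1.
have ux' n : ae_on_halfline (fun s => `|u n s| <= `|x s|).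
  apply: ae_halflineS2 (Eu n).2 (ux n) => s s0 us0 usx.
  by rewrite gee0_abs.
have good : ae_on_halfline (fun s => (forall n, `|u n s| <= `|x s|) /\
    u n s @[n --> \oo] --> 0).
  apply: (@ae_halflineS2 _ (fun s => forall n, `|u n s| <= `|x s|) _ _ _ _ u0) => //.
  have := ae_foralln ux'; apply: (@filterS _ _ (ae_filter_ringOfSetsType mu)).
  by move=> s h hs n; exact: h.
apply: (E_Koc Ex) => [n|n|]; first exact: (Eu n).1.
  apply: carrier_hlp => //; first exact: (Eu n).1.
  by move=> s _; apply: le_rearr_fun.
apply: ae_pos => t t0; apply: ereal_cvg0 => [n|e e0]; first exact: rearr_ge0.
have := distr_cvg0 mx mu_ e0 (distr_lty E_symmetric E_not_one Ex e0) good.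
(* Once the distribution function of [u n] at [e] is at most [t], the rearrangement at [t] is at
   most [e]. *)
move=> /fine_cvgP[dfin /cvgrPdist_le /(_ _ t0) dt].
near=> n; apply: le_rearr_distr => //.
have fn : distr_fun (u n) e \is a fin_num by near: n.
have : (`|0 - fine (distr_fun (u n) e)| <= t)%R by near: n.
by rewrite sub0r normrN ger0_norm ?fine_ge0// -lee_fin fineK.
Unshelve. all: by end_near. Qed.

Lemma rearr_chi_ge (a t : R) : (0 < t < a)%R -> 1 <= rearr (chi `]0%R, a[) t.
Proof.
move=> /andP[t0 ta]; apply: le_ereal_inf_tmp => _ [l [l0 lt] <-].
rewrite lee_fin leNgt; apply/negP => l1; move: lt; apply/negP; rewrite -ltNge.
rewrite distr_chi ?(ltW l0)//; last exact: halfline_sub_itvo.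
by rewrite l1 measure_itv_oo ?subr0 ?lte_fin// ltW// (lt_trans t0).
Qed.

Lemma rearr_scale_chi_le (k a t : R) : (0 < k)%R -> (0 < a)%R -> (0 < t)%R ->
  rearr (fun s => k%:E * chi `]0%R, a[ s) t <= k%:E * chi `]0%R, a[ t.
Proof.
move=> k0 a0 t0; pose v s := k%:E * chi `]0%R, a[ s.
have vle s : `|v s| <= k%:E.
  rewrite /v /chi indicE; case: (_ \in _); first
    by rewrite mule1 gee0_abs// lee_fin ltW.
  by rewrite mule0 abse0 lee_fin ltW.
have [ta|at_] := ltP t a.
  have -> : chi `]0%R, a[ t = 1 by rewrite /chi indicE mem_set//= in_itv /= t0.
  rewrite mule1; apply: le_rearr_distr => //.
  rewrite /distr_fun (_ : _ `&` _ = set0) ?measure0 ?lee_fin ?(ltW t0)//.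
  by apply/seteqP; split => // s [_ /=]; rewrite ltNge vle.
have -> : chi `]0%R, a[ t = 0.
  by rewrite /chi indicE memNset//= in_itv /= t0 ltNge at_.
rewrite mule0; apply/lee_addgt0Pr => l l0; rewrite add0e; apply: le_rearr_distr => //.
apply: (@le_trans _ _ (mu `]0%R, a[)); last
  by rewrite measure_itv_oo ?subr0 ?lee_fin// ltW.
apply: le_measure; rewrite ?inE; [|exact: measurable_itv|].
  apply: measurable_distr_set; apply: measurable_funeM; exact: L0_chi.
move=> s [_ ls]; have [//|sa] := pselect (`]0%R, a[%classic s).
have : l%:E < `|v s| by exact: ls.
by rewrite /v /chi indicE memNset// mule0 abse0 lte_fin ltNge (ltW l0).
Qed.

Lemma K_oc_not_embedded : ~ embedded_in_L1 E.
Proof.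
move=> [_ [C C0 bC]].
pose x := chi `]0%R, 1%R[ : R -> \bar R.
pose k (n : nat) : R := (n.+1%:R^-1)%R.
have k0 n : (0 < k n)%R by rewrite invr_gt0.
pose u (n : nat) s := (k n)%:E * chi `]0%R, n.+1%:R[ s.
have Ex : bfs_carrier E x by exact: carrier_chi_itvo.
have Ech n := carrier_chi_itvo E_symmetric n.+1%:R.
have Eu n : bfs_carrier E (u n) by exact: bfs_scale.
have u_ge0 n s : 0 <= u n s by rewrite mule_ge0 ?chi_ge0// lee_fin ltW.
have int_u n : \int[mu]_(s in halfline R) `|u n s| = 1.
  transitivity (\int[mu]_(s in halfline R) (cst (k n)%:E s * chi `]0%R, n.+1%:R[ s)).
    by apply: eq_integral => s _; rewrite gee0_abs.
  rewrite integral_mulchi// setIidr; last exact: halfline_sub_itvo.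
  by rewrite integral_cst_oo// subr0 -EFinM divff.
have : nrm (u n) @[n --> \oo] --> 0%R.
  apply: (E_Koc Ex Eu).
  - move=> n; split; [| |move=> t t0].
    + by apply: (carrier_L1_plus_Linfty E_symmetric (Eu n));
        exact: distr_lty (Eu n) ltr01.
    + by apply: (carrier_L1_plus_Linfty E_symmetric Ex); exact: distr_lty Ex ltr01.
    + apply: lee_wpmul2l; first by rewrite lee_fin invr_ge0 ltW.
      have mun : L0 (u n) := bfs_measurable (Eu n).
      (* One-sided bounds on the two rearrangements suffice: what remains is min(t, n+1)/(n+1) <=
         min(t, 1). *)
      apply: (@le_trans _ _ (\int[mu]_(s in `]0%R, t[) u n s)).
        apply: le_integral_itvo => //; [exact: L0_rearr|by move=> s _;
          exact: rearr_ge0|].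
        by move=> s /andP[s0 _]; exact: rearr_scale_chi_le.
      apply: (@le_trans _ _ (\int[mu]_(s in `]0%R, t[) x s)); last first.
        apply: le_integral_itvo; [exact: L0_chi|exact: L0_rearr|by move=> s _;
          exact: chi_ge0|].
        move=> s /andP[s0 _]; rewrite {1}/x /chi indicE.
        have [|_] := boolP (s \in _); last exact: rearr_ge0.
        by rewrite inE /= in_itv /= => s1; exact: rearr_chi_ge.
      rewrite (integral_itvo_chi t n.+1%:R (cst (k n)%:E)).
      have -> : \int[mu]_(s in `]0%R, t[) x s =
          \int[mu]_(s in `]0%R, t[) (cst 1 s * chi `]0%R, 1%R[ s).
        by apply: eq_integral => s _; rewrite mul1e.
      rewrite integral_itvo_chi !integral_cst_oo ?le_min ?(ltW t0)//= !subr0.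
      rewrite -!EFinM lee_fin mulr1 le_min ler_pdivrMr// ler_pdivrMr// mul1r.
      rewrite !ge_min lexx orbT andbT ler_peMr ?ler1n ?(ltW t0)//.
  - apply: ae_pos => t t0; apply: ereal_cvg0 => [n|e e0]; first exact: rearr_ge0.
    exists (Num.truncn e^-1) => // n /= en.
    apply: (le_trans (rearr_scale_chi_le (k0 n) _ t0)) => //.
    apply: (@le_trans _ _ (k n)%:E).
      rewrite /chi indicE; case: (_ \in _); first by rewrite mule1.
      by rewrite mule0 lee_fin ltW.
    rewrite lee_fin /k invf_ple ?posrE// ltW//.
    by apply: lt_le_trans (truncnS_gt _) _; rewrite ler_nat ltnS.
(* All [u n] have integral 1, so a norm of at most 1/(C+1) would give 1 <= C/(C+1). *)
have C10 : (0 < (C + 1)^-1)%R by rewrite invr_gt0 addr_gt0.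
move=> /cvgrPdist_le /(_ _ C10)[n _ /(_ n (leqnn _))].
rewrite sub0r normrN ger0_norm ?bfs_norm_ge0// => un.
have := bC _ (Eu n); rewrite int_u lee_fin leNgt => /negP; apply.
apply: (@le_lt_trans _ _ (C * (C + 1)^-1)%R); first by rewrite ler_wpM2l// ltW.
by rewrite ltr_pdivrMr ?addr_gt0// mul1r ltrDl.
Qed.

End converse.

Theorem theorem3p3 (R : realType) (E : banach_function_space R)
    (E_symmetric : symmetric_space E) (E_fatou : fatou_property E) :
  [<-> order_continuous E /\ ~ embedded_in_L1 E ;
       order_continuous E /\
         (forall f : R -> \bar R, associate_space E f -> rearr_infty f = 0%E) ;
       K_order_continuous E /\ fundamental_infty E = +oo%E].
Proof.
tfae.
- move=> [oc nemb]; split => // f E'f; apply: rearr_infty_eq0 => c.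
  exact: (associate_distr_lty E_symmetric E_fatou nemb E'f).
- move=> [oc E'0]; split.
    by apply: oc_K_order_continuous => //; exact: not_embedded_of_associate.
  by apply/fundamental_inftyP => //; exact: oc_not_carrier_one.
- move=> [Koc /(fundamental_inftyP E_symmetric E_fatou) nE1]; split.
    exact: K_oc_order_continuous.
  exact: K_oc_not_embedded.
Qed.
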